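(* Let $d \geq 2$ be an integer, $\mu$ a probability measure on $\mathbb{Z}^d$ and $A \in \mathrm{GL}_d(\mathbb{Z})$. Let $(B_t)_{t\ge 1}$ be i.i.d. random variables with law $\mu$, and for each integer $n \ge 1$ let $(X_t)_{t \ge 0}$ be the random walk on $(\mathbb{Z}/n\mathbb{Z})^d$ defined by $X_0 = 0$ and $X_t = A X_{t-1} + B_t \bmod n$ for $t \ge 1$. Let $P^t(0,\cdot)$ be the law of $X_t$ and $U$ the uniform measure on $(\mathbb{Z}/n\mathbb{Z})^d$ (both depend on $n$). Let $H$ be the smallest $A$-invariant subgroup of $\mathbb{Z}^d$ that contains $\operatorname{supp}\mu - \operatorname{supp}\mu$. Suppose that $H$ has rank $d$ and is generated by $(a_i u_i)_{i=1}^d$ for some basis $(u_i)_{i=1}^d$ of $\mathbb{Z}^d$ and positive integers $(a_i)_{i=1}^d$. If $A$ is hyperbolic, then there exists a constant $C>0$ (not depending on $n$) such that, as $n \to \infty$ along the integers $n$ that are coprime with all the $a_i$, $$\sup_{t > C \log n \log\log n} \left\| P^t(0,\cdot) - U \right\|_{\mathrm{TV}} \longrightarrow 0 .$$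
   Context: $\mathrm{GL}_d(\mathbb{Z})$ is the set of invertible $d\times d$ matrices with integer entries whose inverse has integer entries. A matrix is hyperbolic if it has no (complex) eigenvalue of modulus $1$. $\operatorname{supp}\mu - \operatorname{supp}\mu = \{x-y : x,y \in \operatorname{supp}\mu\}$. A basis of $\mathbb{Z}^d$ means a family of $d$ elements generating $\mathbb{Z}^d$ as a group. For probability measures $p,q$ on a finite set $X$, $\|p-q\|_{\mathrm{TV}} = \max_{S \subseteq X} |p(S)-q(S)| = \frac12 \sum_{x\in X} |p(x)-q(x)|$. $\log$ is the natural logarithm. *)

(* Defs.v *)
From HB Require Import structures.
From mathcomp Require Import all_boot all_order all_algebra complex.
From mathcomp Require Import all_classical all_reals all_analysis.
Set Implicit Arguments.
Unset Strict Implicit.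
Unset Printing Implicit Defensive.
Import Order.TTheory GRing.Theory Num.Theory.
Import numFieldNormedType.Exports.
Local Open Scope classical_set_scope.
Local Open Scope ring_scope.

HB.instance Definition _ := isPointed.Build int 0.

HB.instance Definition _ (d : nat) :=
  @isMeasurable.Build default_measure_display 'cV[int]_d
    discrete_measurable discrete_measurable0
    discrete_measurableC discrete_measurableU.

(* The sigma-algebra is discrete, so the support is the set of atoms. *)
Definition supp (R : realType) (d : nat)
  (mu : probability 'cV[int]_d R) : set 'cV[int]_d :=
  [set x | mu [set x] != 0%E].

Definition hyperbolic (R : realType) (d : nat) (A : 'M[int]_d) : Prop :=
  forall z : R[i], eigenvalue (map_mx intr A : 'M[R[i]]_d) z -> `|z| != 1.

Definition subgroup (V : zmodType) (H : set V) : Prop := zmod_closed (mem H).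

Definition generated (V : zmodType) (G : set V) : set V :=
  smallest (@subgroup V) G.

Definition int_independent (V : zmodType) (r : nat) (v : 'I_r -> V) : Prop :=
  forall c : 'I_r -> int, \sum_i v i *~ c i = 0 -> forall i, c i = 0.

Definition has_rank (V : zmodType) (H : set V) (r : nat) : Prop :=
  (exists2 v : 'I_r -> V, range v `<=` H & int_independent v) /\
  (forall (s : nat) (v : 'I_s -> V),
     range v `<=` H -> int_independent v -> (s <= r)%N).

Definition Zbasis (d : nat) (u : 'I_d -> 'cV[int]_d) : Prop :=
  generated (range u) = [set: 'cV[int]_d].

Definition mx_invariant (d : nat) (A : 'M[int]_d) (H : set 'cV[int]_d) : Prop :=
  forall x, H x -> H (A *m x).

Definition invariant_hull (d : nat) (A : 'M[int]_d) (G : set 'cV[int]_d) :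
  set 'cV[int]_d := smallest [set H | subgroup H /\ mx_invariant A H] G.

Definition mutually_independent (R : realType) (d d' : measure_display)
  (T : measurableType d) (T' : measurableType d') (P : probability T R)
  (I : choiceType) (D : set I) (X : I -> {RV P >-> T'}) : Prop :=
  forall (J : seq I) (E : I -> set T'), uniq J -> [set` J] `<=` D ->
    (forall i, measurable (E i)) ->
    P (\bigcap_(i in [set` J]) (X i @^-1` E i)) =
    (\prod_(i <- J) P (X i @^-1` E i))%E.

Definition iid (R : realType) (d d' : measure_display)
  (T : measurableType d) (T' : measurableType d') (P : probability T R)
  (I : choiceType) (D : set I) (X : I -> {RV P >-> T'})
  (mu : probability T' R) : Prop :=
  mutually_independent D X /\
  (forall i, D i -> forall E, measurable E -> distribution P (X i) E = mu E).

(* ['Z_n] is Z/nZ for 1 < n only; the values n = 0 and n = 1 are irrelevant to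
   limits as n tends to infinity.  [b 0] is not used. *)
Fixpoint walk (d : nat) (A : 'M[int]_d) (n : nat) (b : nat -> 'cV[int]_d)
  (t : nat) : 'cV['Z_n]_d :=
  if t is t'.+1 then map_mx intr A *m walk A n b t' + map_mx intr (b t)
  else 0.

Definition finlaw (R : realType) (d : measure_display) (T : measurableType d)
  (P : probability T R) (X : finType) (Y : T -> X) (S : {set X}) : R :=
  fine (P [set w | Y w \in S]).

Definition finuniform (R : realType) (X : finType) (S : {set X}) : R :=
  #|S|%:R / #|X|%:R.

Definition tv_dist (R : realType) (X : finType) (p q : {set X} -> R) : R :=
  \big[Num.max/0]_(S : {set X}) `|p S - q S|.

(* Main.v *)
Require Import Defs.
From HB Require Import structures.
From mathcomp Require Import all_boot all_order all_algebra complex.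
From mathcomp Require Import all_classical all_reals all_analysis.
From mathcomp Require Import ring lra zify.
Import Order.TTheory GRing.Theory Num.Theory.
Import numFieldNormedType.Exports.
Local Open Scope classical_set_scope.
Local Open Scope ring_scope.

Set Implicit Arguments.
Unset Strict Implicit.
Unset Printing Implicit Defensive.
Import Normc.

(** Fourier analysis turns the distance to uniformity into the sum, over the
    non-zero characters [xi] of (Z/n)^d, of |ft xi|^2, where [ft] is the
    Fourier transform of the law of the walk ([sum_deviation_le]). Since one
    step of the walk convolves with [mu] and applies [A], this coefficient
    is a product, over the times s < t, of coefficients of [mu] along the
    orbit of [xi] under the transpose of [A] ([ft_walk]). So the question is
    how often such an orbit visits characters at which the coefficient of
    [mu] is far from 1. A union bound over [xi] would cost a factor log n;
    counting the orbits that make few good visits reduces it to log log n,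
    as in the work of Chung, Diaconis and Graham on multiplication by 2.

    Counting rests on a symbolic coding. With a = prod a_i, lift a.xi to an
    integer vector with entries in [-n/2, n/2). Applying the transpose of
    [A] to the lift gives the lift of the next point of the orbit plus n
    times a bounded integer vector, the digit of [xi]. Two properties make
    this code useful.

    - A non-zero digit means that the lift has an entry of order n. The
      vectors h such that 1 - cos (2 pi <h, xi> / n) is at most a constant
      times the sum of the losses 1 - |ft mu|^2 over boundedly many steps of
      the orbit form an [A]-invariant subgroup containing supp mu - supp mu,
      so they contain [H], hence a.Z^d. Therefore each non-zero digit costs
      the product a constant factor ([gap_code], [ft_walk_le]).

    - The first c log n digits determine [xi] ([code_separates]). If two
      characters have the same digits, the difference of their lifts is an
      integer vector whose orbit stays bounded by n for that long.
      Hyperbolicity makes it smaller than 1 in the middle of the time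
      interval, hence 0 ([hyperbolic_orbit_vanish]); and multiplication by a
      is injective on (Z/n)^d because n is coprime with all the a_i.

    Let m = c log n and cut the time into r blocks of length m. By the
    inequality of arithmetic and geometric means, and because the transpose
    of [A] permutes the non-zero characters, the sum over all [xi] of the
    product over the r blocks is at most the sum of the r-th power of one
    block. Summing the latter over all words of length m other than 0 ... 0
    gives (1 + Q th^r)^m - 1 with th < 1 ([fourier_bound]). This tends to 0
    once r exceeds a constant multiple of log m, that is, after a multiple
    of log n log log n steps ([code_mass_small]). *)

(** * Orbits of hyperbolic integer matrices *)

Lemma contraction_iter (R : realFieldType) (x : nat -> R) (b e : R) (L : nat) :
  0 <= b -> b < 1 -> 0 <= e ->
  (forall j, (j < L)%N -> x j.+1 <= b * x j + e) ->
  x L <= b ^+ L * x 0%N + e / (1 - b).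
Proof.
move=> b0 b1 e0; have b1' : 0 < 1 - b by lra.
elim: L => [_|L IH hx]; first by rewrite expr0 mul1r lerDl divr_ge0// ltW.
apply: (le_trans (hx L _)) => //.
have := IH (fun j hj => hx j (ltnW hj)) => /(ler_wpM2l b0).
rewrite mulrDr mulrA -exprS => h.
apply: (@le_trans _ _ (b ^+ L.+1 * x 0%N + b * (e / (1 - b)) + e)).
  by rewrite lerD2r.
rewrite -addrA lerD2l le_eqVlt; apply/orP; left; apply/eqP.
by field; rewrite gt_eqF.
Qed.

(** The factor E - z of a linear recurrence, E being the shift of sequences. *)
Definition peel (R : rcfType) (v : nat -> R[i]) (z : R[i]) : nat -> R[i] :=
  fun s => v s.+1 - z * v s.

Lemma normc_ge0 (R : rcfType) (x : R[i]) : 0 <= normc x.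
Proof. by case: x => a b /=; rewrite sqrtr_ge0. Qed.

Lemma le_normcB (R : rcfType) (x y : R[i]) :
  normc (x - y) <= normc x + normc y.
Proof. by rewrite -(normcN y) le_normcD. Qed.

(** The relation v (s + 1) = z v s + peel v z s contracts forwards in time
    if |z| < 1 and backwards if |z| > 1; starting from the end of the window
    [s - L, s + L] from which it contracts, the initial value is damped L
    times. *)
Lemma peel_bound (R : rcfType) (z : R[i]) : normc z != 1 ->
  exists b c : R, [/\ 0 <= b, b < 1, 0 <= c &
    forall (v : nat -> R[i]) (N e : R) (s L : nat), 0 <= e -> (L <= s)%N ->
      (forall j, (s - L <= j <= s + L)%N -> normc (v j) <= N) ->
      (forall j, (s - L <= j < s + L)%N -> normc (peel v z j) <= e) ->
      normc (v s) <= b ^+ L * N + c * e].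
Proof.
case: ltgtP => // hz _; set r := normc z.
  exists r, (1 - r)^-1; split=> //; first exact: normc_ge0.
    by rewrite invr_ge0 subr_ge0 ltW.
  move=> v N e s L e0 Ls hv hp.
  have := @contraction_iter _ (fun j => normc (v (s - L + j)%N)) r e L
    (normc_ge0 _) hz e0.
  rewrite subnK // addn0 => h; apply: (le_trans (h _)).
    move=> j jL; rewrite addnS -normcM.
    have -> : v (s - L + j).+1 =
      z * v (s - L + j)%N + peel v z (s - L + j)%N by rewrite /peel addrC subrK.
    apply: (le_trans (le_normcD _ _)); rewrite lerD2l; apply: hp; lia.
  rewrite [c in _ + c]mulrC lerD2r ler_wpM2l ?exprn_ge0 ?normc_ge0//.
  apply: hv; lia.
have r0 : 0 < r by apply: lt_trans hz.
have z0 : z != 0 by apply: contraTneq hz => ->; rewrite normc0; lra.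
exists r^-1, (r^-1 / (1 - r^-1)).
have r1 : r^-1 < 1 by rewrite invf_lt1.
split=> //; first by rewrite invr_ge0 ltW.
  by rewrite divr_ge0 ?invr_ge0 ?subr_ge0 ?ltW.
move=> v N e s L e0 Ls hv hp.
have := @contraction_iter _ (fun j => normc (v (s + L - j)%N))
  r^-1 (r^-1 * e) L.
rewrite addnK subn0 => h; apply: (le_trans (h _ _ _ _)) => //.
- by rewrite invr_ge0 ltW.
- by rewrite mulr_ge0 // invr_ge0 ltW.
- move=> j jL; set k := (s + L - j.+1)%N.
  have -> : (s + L - j = k.+1)%N by rewrite /k; lia.
  have -> : v k = z^-1 * (v k.+1 - peel v z k) by rewrite /peel subKr mulKf.
  rewrite normcM normcV -mulrDr.
  apply: ler_wpM2l; first by rewrite invr_ge0 ltW.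
  apply: (le_trans (le_normcB _ _)); rewrite lerD2l; apply: hp; rewrite /k; lia.
rewrite [_ * e]mulrAC lerD2r.
apply: ler_wpM2l; first by rewrite exprn_ge0 // invr_ge0 ltW.
apply: hv; lia.
Qed.

(** Hyperbolic recurrences are small in the middle of any window on which
    they are bounded: peeling off all the roots leaves 0, and putting them
    back one by one only adds boundary terms damped by k^L. Each root uses
    up a margin of L + 1 on both sides, where the 1 is there because [peel v
    z s] depends on v (s + 1). *)
Lemma recurrence_small (R : rcfType) (zs : seq R[i]) :
  (forall z, z \in zs -> normc z != 1) ->
  exists c k : R, [/\ 0 <= c, 0 < k, k < 1 &
    forall (v : nat -> R[i]) (N : R) (q L : nat),
      (forall s, (s <= q)%N -> normc (v s) <= N) ->
      (forall s, foldl (@peel R) v zs s = 0) ->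
      forall s, (size zs * L.+1 <= s)%N -> (s + size zs * L.+1 <= q)%N ->
        normc (v s) <= c * N * k ^+ L].
Proof.
elim: zs => [|z zs IH] hzs.
  exists 0, 2^-1; split=> //; try lra.
  by move=> v N q L _ /= h s _ _; rewrite h normc0 !mul0r.
have [|c [k [c0 k0 k1 hk]]] := IH.
  by move=> y ys; apply: hzs; rewrite inE ys orbT.
have /peel_bound[b [c' [b0 b1 c'0 hb]]] := hzs z (mem_head _ _).
(* 1 - (1 - k) (1 - b) is less than 1 and dominates both rates. *)
exists (1 + c' * c * (1 + normc z)), (k + b - k * b).
have z0 := normc_ge0 z.
have kb : k <= k + b - k * b by nra.
have bk : b <= k + b - k * b by nra.
split.
- by rewrite addr_ge0 // !mulr_ge0 // addr_ge0.
- exact: lt_le_trans kb.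
- by nra.
move=> v N q L hv h s; rewrite [size _]/= mulSn.
have {}hk := fun w N' q' => hk w N' q' L.
move: (size zs * L.+1)%N hk => p hk hs1 hs2.
have N0 : 0 <= N by apply: le_trans (hv 0%N _); rewrite ?normc_ge0.
have q0 : (0 < q)%N by clear -hs1 hs2; lia.
have hw : forall j, (p <= j)%N -> (j + p <= q.-1)%N ->
    normc (peel v z j) <= c * ((1 + normc z) * N) * k ^+ L.
  apply: hk => // j jq.
  have jq' : (j.+1 <= q)%N by clear -jq q0; lia.
  apply: (le_trans (le_normcB _ _)); rewrite mulrDl mul1r lerD//.
    exact: hv.
  by rewrite normcM ler_wpM2l ?normc_ge0//; apply/hv/ltnW.
have kL0 : 0 <= k ^+ L by rewrite exprn_ge0 // ltW.
have zN0 : 0 <= (1 + normc z) * N by rewrite mulr_ge0 // addr_ge0.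
apply: (le_trans (hb v N (c * ((1 + normc z) * N) * k ^+ L) s L _ _ _ _)).
- by apply: mulr_ge0 => //; apply: mulr_ge0.
- by clear -hs1; lia.
- by move=> j hj; apply: hv; clear -hj hs2; lia.
- by move=> j hj; apply: hw; clear -hj hs1 hs2; lia.
set K := _ - _ in kb bk *.
have kK : k ^+ L <= K ^+ L by rewrite lerXn2r ?nnegrE //; lra.
have bK : b ^+ L <= K ^+ L by rewrite lerXn2r ?nnegrE //; lra.
have -> : (1 + c' * c * (1 + normc z)) * N * K ^+ L =
  K ^+ L * N + c' * (c * ((1 + normc z) * N) * K ^+ L) by ring.
apply: lerD; first exact: ler_wpM2r.
by rewrite ler_wpM2l // ler_wpM2l // mulr_ge0.
Qed.

(** The shift acts as [M] on the entries of an orbit of [M], so peeling off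
    z applies M - z to the orbit. *)
Lemma foldl_peel_mx (R : rcfType) (d : nat) (M : 'M[R[i]]_d.+1)
  (Y : 'cV[R[i]]_d.+1) (i : 'I_d.+1) (zs : seq R[i]) (Q : 'M[R[i]]_d.+1) s :
  foldl (@peel R) (fun s => (M ^+ s *m (Q *m Y)) i 0) zs s =
  (M ^+ s *m (\prod_(z <- zs) (M - z%:M) *m Q *m Y)) i 0.
Proof.
elim: zs Q s => [|z zs IH] Q s /=; first by rewrite big_nil mul1mx.
have -> : peel (fun s => (M ^+ s *m (Q *m Y)) i 0) z =
  (fun s => (M ^+ s *m ((M - z%:M) *m Q *m Y)) i 0).
  apply/funext => t; rewrite /peel.
  have -> : (M - z%:M) *m Q *m Y = M *m (Q *m Y) - z *: (Q *m Y).
    by rewrite !mulmxBl mul_scalar_mx -scalemxAl !mulmxA.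
  by rewrite mulmxBr -scalemxAr exprSr -mulmxE !mulmxA !mxE.
have cs (a : R[i]) (B : 'M[R[i]]_d.+1) : GRing.comm B a%:M.
  by rewrite /GRing.comm -!mulmxE scalar_mxC.
have cm : GRing.comm (M - z%:M) (\prod_(y <- zs) (M - y%:M)).
  apply: commr_prod => y _; apply: commrB => //.
  by apply/commr_sym/commrB => //; apply: commr_refl.
by rewrite IH big_cons cm -mulmxE !mulmxA.
Qed.

Lemma expr_small (R : realType) (k e : R) : 0 <= k -> k < 1 -> 0 < e ->
  exists m : nat, k ^+ m <= e.
Proof.
move=> k0 k1 e0.
have /cvgr0Pnorm_le /(_ _ e0) [m _ hm] : k ^+ n @[n --> \oo] --> (0 : R).
  by apply: cvg_expr; rewrite ger0_norm.
by exists m; have := hm m (leqnn _); rewrite /= ger0_norm ?exprn_ge0.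
Qed.

Lemma normc_int (R : rcfType) (m : int) : normc (m%:~R : R[i]) = `|m|%:~R.
Proof.
have -> : (m%:~R : R[i]) = (m%:~R : R)%:C%C by rewrite rmorph_int.
by rewrite /= expr0n /= addr0 sqrtr_sqr intr_norm.
Qed.

Lemma char_poly_trmx (R : comNzRingType) (d : nat) (M : 'M[R]_d) :
  char_poly M^T = char_poly M.
Proof.
rewrite /char_poly -[RHS]det_tr; congr (\det _).
by rewrite /char_poly_mx linearB /= tr_scalar_mx map_trmx.
Qed.

Lemma expr_unitmx (R : comUnitRingType) (d : nat) (M : 'M[R]_d.+1) s :
  M \in unitmx -> M ^+ s \in unitmx.
Proof.
move=> hM; elim: s => [|s IH]; first by rewrite expr0 unitmx1.
by rewrite exprS -mulmxE unitmx_mul hM.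
Qed.

Lemma map_mx_expr (R S : nzRingType) (f : {rmorphism R -> S}) (d : nat)
  (M : 'M[R]_d.+1) t : map_mx f (M ^+ t) = map_mx f M ^+ t.
Proof.
elim: t => [|t IH]; first by rewrite !expr0 map_mx1.
by rewrite !exprS -!mulmxE map_mxM IH.
Qed.

(** By Cayley-Hamilton the entries of an orbit satisfy a recurrence whose
    roots are the eigenvalues. An orbit bounded by n during a time c log n
    is less than 1 in the middle, and it consists of integer vectors; so it
    is 0 there, and everywhere since [A] is invertible. *)
Lemma hyperbolic_orbit_vanish (R : realType) (d : nat) (A : 'M[int]_d.+1) :
  A \in unitmx -> hyperbolic R A ->
  exists c : nat, forall (n : nat) (Y : 'cV[int]_d.+1),
    (forall s, (s <= c * (trunc_log 2 n).+1)%N ->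
       forall i, `|(A^T ^+ s *m Y) i 0| <= n%:Z) -> Y = 0.
Proof.
move=> hA hyp.
pose M : 'M[R[i]]_d.+1 := map_mx intr A^T.
have [zs hzs] := closed_field_poly_normal (char_poly M).
move: hzs; rewrite (monicP (char_poly_monic _)) scale1r => hzs.
have [|c [k [c0 k0 k1 hk]]] := @recurrence_small R zs.
  move=> z zin.
  have : eigenvalue (map_mx intr A : 'M[R[i]]_d.+1) z.
    rewrite eigenvalue_root_char -char_poly_trmx map_trmx -/M hzs.
    by rewrite root_prod_XsubC.
  move=> /hyp; apply: contraNneq => h.
  by rewrite [`|_|]/((normc z)%:C%C) h.
have p0 : 0 < (2 * (c + 1))^-1 by rewrite invr_gt0 mulr_gt0 // ltr_wpDl.
have [e he] := expr_small (ltW k0) k1 p0.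
(* s is the middle of the window [0, 2 s]; by the choice of e the damping over
   e * l steps is at most 2^-l / (c + 1), while n < 2^l. *)
exists (2 * size zs * e.+1)%N => n Y hY.
set l := (trunc_log 2 n).+1 in hY.
set L := (e * l)%N.
set s := (size zs * L.+1)%N.
suff h0 : A^T ^+ s *m Y = 0.
  have hu : A^T ^+ s \in unitmx by apply: expr_unitmx; rewrite unitmx_tr.
  by rewrite -(mulKmx hu Y) h0 mulmx0.
apply/colP => i; rewrite [RHS]mxE.
pose v (t : nat) : R[i] := (M ^+ t *m (1%:M *m map_mx intr Y)) i 0.
have vE t : v t = ((A^T ^+ t *m Y) i 0)%:~R.
  rewrite /v mul1mx /M.
  by rewrite -map_mx_expr -map_mxM mxE.
have : normc (v s) <= c * n%:R * k ^+ L.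
  apply: (hk v n%:R (s + s)%N L) => //.
  - move=> t ht; rewrite vE normc_int -[n%:R]/(n%:Z%:~R) ler_int; apply: hY.
    apply: (leq_trans ht); rewrite /s /L /l; nia.
  - move=> t; rewrite foldl_peel_mx.
    suff -> : \prod_(z <- zs) (M - z%:M) = 0 by rewrite !mul0mx !mulmx0 mxE.
    have := Cayley_Hamilton M; rewrite hzs rmorph_prod /= => <-.
    by apply: eq_bigr => z _; rewrite rmorphB /= horner_mx_X horner_mx_C.
move=> hs.
suff : normc (v s) < 1.
  by rewrite vE normc_int -[1]/(1%:~R) ltr_int => ?; lia.
apply: (le_lt_trans hs).
have hl : n%:R < 2 ^+ l :> R by rewrite -natrX ltr_nat trunc_log_ltn.
have hkL : k ^+ L <= (2 ^+ l * (c + 1))^-1.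
  rewrite /L exprM; apply: (@le_trans _ _ ((2 * (c + 1))^-1 ^+ l)).
    by rewrite lerXn2r ?nnegrE ?exprn_ge0 ?invr_ge0 ?mulr_ge0 ?addr_ge0 // ltW.
  rewrite exprVn exprMn lef_pV2 ?posrE ?mulr_gt0 ?exprn_gt0 ?ltr_wpDl //.
  rewrite ler_pM2l ?exprn_gt0 // /l exprS ler_peMr ?addr_ge0 //.
  by rewrite exprn_ege1 // lerDr.
have l0 : 0 < 2 ^+ l :> R by rewrite exprn_gt0.
apply: (@le_lt_trans _ _ (c * 2 ^+ l * (2 ^+ l * (c + 1))^-1)).
  apply: ler_pM => //; first by rewrite mulr_ge0.
    by rewrite exprn_ge0 // ltW.
  by rewrite ler_wpM2l // ltW.
rewrite ltr_pdivrMr ?mul1r ?mulr_gt0 ?ltr_wpDl //.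
by rewrite mulrC ltr_pM2l //; lra.
Qed.

(** * Fourier analysis on finite tori *)

Lemma intr_Zp_eq0 (n : nat) (m : int) : (1 < n)%N ->
  (m%:~R == 0 :> 'Z_n) = (n %| m)%Z.
Proof.
move=> n1.
have nat0 (k : nat) : (k%:R == 0 :> 'Z_n) = (n %| k)%N.
  by rewrite -val_eqE /= val_Zp_nat.
case: (intP m) => [|k|k]; first by rewrite eqxx dvdz0.
  by rewrite -[k.+1%:~R]/(k.+1%:R) nat0 dvdzE.
by rewrite mulrNz oppr_eq0 -[k.+1%:~R]/(k.+1%:R) nat0 dvdzE abszN.
Qed.

Definition cis (R : realType) (x : R) : R[i] := (cos x +i* sin x)%C.

Section cis.
Variable R : realType.
Implicit Types x y : R.

Lemma cisD x y : cis (x + y) = cis x * cis y.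
Proof.
rewrite /cis cosD sinD.
by apply/eqP; rewrite eq_complex /= eqxx /= addrC.
Qed.

Lemma cis0 : cis (0 : R) = 1.
Proof. by rewrite /cis cos0 sin0. Qed.

Lemma normc_cis x : normc (cis x) = 1.
Proof. by rewrite /= cos2Dsin2 sqrtr1. Qed.

Lemma cis_nat k : cis (2 * pi * k%:R : R) = 1.
Proof.
elim: k => [|k IH]; first by rewrite mulr0 cis0.
have -> : 2 * pi * k.+1%:R = 2 * pi * k%:R + pi *+ 2 :> R.
  by rewrite -natr1 -[pi *+ 2]mulr_natl; ring.
by rewrite cisD IH mul1r /cis cos2pi sin2pi.
Qed.

Lemma cis_int (m : int) : cis (2 * pi * m%:~R : R) = 1.
Proof.
case: m => k; first exact: cis_nat.
have : cis (2 * pi * k.+1%:R) * cis (2 * pi * (Negz k)%:~R) = 1 :> R[i].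
  rewrite -cisD -mulrDr -[k.+1%:R]/(k.+1%:Z%:~R) -intrD NegzE addrN.
  by rewrite mulr0 cis0.
by rewrite cis_nat mul1r.
Qed.

End cis.

Section cent.
Variable n : nat.
Hypothesis n1 : (1 < n)%N.

(** The representative of x in [-n/2, n/2). *)
Definition cent (x : 'Z_n) : int :=
  if (x.*2 < n)%N then (x : nat)%:Z else (x : nat)%:Z - n%:Z.

Lemma centK x : (cent x)%:~R = x.
Proof.
have E : (x : nat)%:Z%:~R = x by rewrite -[_%:~R]/(_%:R) natr_Zp.
rewrite /cent; case: ifP => _ //; rewrite intrB E.
by rewrite -[n%:Z%:~R]/(n%:R) pchar_Zp // subr0.
Qed.

Lemma cent_le x : 2 * `|cent x| <= n%:Z.
Proof.
have hx : (x < n)%N by rewrite -[X in (_ < X)%N](Zp_cast n1).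
rewrite /cent; case: ifP => h; lia.
Qed.

Lemma cent_int (m : int) : 2 * `|m| < n%:Z -> cent m%:~R = m.
Proof.
move=> hm; have h := cent_le m%:~R.
have : (n %| cent m%:~R - m)%Z.
  by rewrite -intr_Zp_eq0 // intrB centK subrr.
case/dvdzP => q hq.
have : q = 0 by nia.
by move=> q0; rewrite q0 mul0r in hq; apply/eqP; rewrite -subr_eq0 hq.
Qed.

End cent.

Definition chi (R : realType) (n : nat) (x : 'Z_n) : R[i] :=
  cis (2 * pi * x%:R / n%:R).

Section chi.
Variables (R : realType) (n : nat).
Hypothesis n1 : (1 < n)%N.
Let n0 : n%:R != 0 :> R. Proof. by rewrite pnatr_eq0; case: (n) n1. Qed.
Local Notation chi := (@chi R n).

Lemma chi_int (m : int) : chi m%:~R = cis (2 * pi * m%:~R / n%:R).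
Proof.
have : (n %| m - (m%:~R : 'Z_n)%:Z)%Z.
  by rewrite -intr_Zp_eq0 // intrB -[(_ : 'Z_n)%:Z%:~R]/(_%:R) natr_Zp subrr.
case/dvdzP => q hq.
have -> : m = q * n + (m%:~R : 'Z_n)%:Z by rewrite -hq subrK.
rewrite [in RHS]intrD [in RHS]intrM mulrDr mulrDl mulrA mulfK //.
by rewrite cisD cis_int mul1r -hq subrK.
Qed.

Lemma chiD : {morph chi : x y / x + y >-> x * y}.
Proof.
move=> x y; have E z : chi z = chi (z : nat)%:Z%:~R.
  by rewrite -[_%:~R]/(_%:R) natr_Zp.
rewrite [chi x]E [chi y]E !chi_int -cisD -mulrDl -mulrDr -intrD -chi_int.
by rewrite intrD -![_%:Z%:~R]/(_%:R) !natr_Zp.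
Qed.

Lemma chi0 : chi 0 = 1.
Proof. by rewrite -[0]/(0%:~R) chi_int mulr0 mul0r cis0. Qed.

Lemma normc_chi x : normc (chi x) = 1.
Proof. exact: normc_cis. Qed.

Lemma chiN x : chi (- x) = (chi x)^*%C.
Proof.
have E : (x : nat)%:Z%:~R = x by rewrite -[_%:~R]/(_%:R) natr_Zp.
have -> : chi (- x) = chi (- (x : nat)%:Z)%:~R by rewrite mulrNz E.
rewrite -[X in _ = (chi X)^*%C]E !chi_int.
by rewrite intrN mulrN mulNr /cis cosN sinN.
Qed.

Lemma Re_chi_le1 x : complex.Re (chi x) <= 1.
Proof. exact: cos_le1. Qed.

(** The angle of [chi x] is at most pi in absolute value when computed from
    the centred representative, and the cosine decreases on [0, pi]. *)
Lemma Re_chi_le x (e : R) : 0 <= e -> e * n%:R <= `|cent x|%:~R ->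
  complex.Re (chi x) <= cos (2 * pi * e).
Proof.
move=> e0 he.
have np : 0 < n%:R :> R by rewrite lt0r n0 ler0n.
have p0 : 0 < pi :> R := pi_gt0 R.
rewrite -[x in chi x](centK n1) chi_int /= -cos_norm.
rewrite !normrM normfV (ger0_norm (ltW p0)) !normr_nat -intr_norm.
rewrite -[in X in X <= _]mulrA.
have h1 : e <= `|cent x|%:~R / n%:R by rewrite ler_pdivlMr.
have h2 : `|cent x|%:~R / n%:R <= 1 / 2 :> R.
  rewrite ler_pdivrMr //.
  have : (2 * `|cent x|)%:~R <= n%:Z%:~R :> R by rewrite ler_int (cent_le n1).
  by rewrite intrM -[n%:Z%:~R]/(n%:R); lra.
set y := _ / n%:R in h1 h2 *.
have ey : 2 * pi * e <= 2 * pi * y by nra.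
have y1 : 2 * pi * y <= pi by nra.
case: (ltgtP (2 * pi * e) (2 * pi * y)) ey => // [h _|-> _] //.
by rewrite ltW // ltr_cos // in_itv /=; apply/andP; split=> //; nra.
Qed.

End chi.

Definition dot (S : pzRingType) (d : nat) (xi x : 'cV[S]_d) : S :=
  \sum_i xi i 0 * x i 0.

Section dot.
Variables (S : comPzRingType) (d : nat).
Implicit Types x y : 'cV[S]_d.

Lemma dotE x y : dot x y = (x^T *m y) 0 0.
Proof. by rewrite mxE; apply: eq_bigr => i _; rewrite mxE. Qed.

Lemma dotDr x y z : dot x (y + z) = dot x y + dot x z.
Proof. by rewrite !dotE mulmxDr mxE. Qed.

Lemma dotNr x y : dot x (- y) = - dot x y.
Proof. by rewrite !dotE mulmxN mxE. Qed.

Lemma dot0r x : dot x 0 = 0.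
Proof. by rewrite dotE mulmx0 mxE. Qed.

Lemma dotMnr x y k : dot x (y *+ k) = dot x y *+ k.
Proof.
by elim: k => [|k IH]; rewrite ?mulr0n ?dot0r // !mulrS dotDr IH.
Qed.

Lemma dotC x y : dot x y = dot y x.
Proof. by apply: eq_bigr => i _; rewrite mulrC. Qed.

Lemma dotDl x y z : dot (x + y) z = dot x z + dot y z.
Proof. by rewrite dotC dotDr !(dotC z). Qed.

Lemma dot_mul (M : 'M[S]_d) x y : dot x (M *m y) = dot (M^T *m x) y.
Proof. by rewrite !dotE trmx_mul trmxK mulmxA. Qed.

Lemma dot_delta x i : dot (delta_mx i 0) x = x i 0.
Proof.
rewrite /dot (bigD1 i) //= !mxE !eqxx mul1r big1 ?addr0 // => j ji.
by rewrite mxE (negbTE ji) mul0r.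
Qed.

End dot.

Lemma sqr_normcE (R : rcfType) (z : R[i]) :
  normc z ^+ 2 = complex.Re (z * z^*%C).
Proof.
case: z => a b /=; rewrite sqr_sqrtr ?addr_ge0 ?sqr_ge0 //.
by rewrite mulrN opprK !expr2.
Qed.

Lemma Re_sum (R : rcfType) (I : finType) (F : I -> R[i]) :
  complex.Re (\sum_i F i) = \sum_i complex.Re (F i).
Proof. by apply: (big_morph (@complex.Re R)) => // -[a b] [c e]. Qed.

Lemma Re_realM (R : rcfType) (a : R) (z : R[i]) :
  complex.Re (a%:C%C * z) = a * complex.Re z.
Proof. by case: z => x y /=; rewrite mul0r subr0. Qed.

Lemma Re_nat (R : rcfType) k : complex.Re (k%:R : R[i]) = k%:R.
Proof. by rewrite -(rmorph_nat (real_complex R)). Qed.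

Lemma conj_sum (R : rcfType) (I : finType) (F : I -> R[i]) :
  (\sum_i F i)^*%C = \sum_i (F i)^*%C.
Proof.
apply: (big_morph (fun z : R[i] => z^*%C)); last by rewrite /= oppr0.
by move=> [a b] [c e]; apply/eqP; rewrite eq_complex /= opprD !eqxx.
Qed.

Lemma conj_realM (R : rcfType) (a : R) (z : R[i]) :
  (a%:C%C * z)^*%C = a%:C%C * z^*%C.
Proof.
case: z => x y; apply/eqP.
by rewrite eq_complex /= !mul0r !subr0 !addr0 mulrN !eqxx.
Qed.

Definition ft (R : realType) (n d : nat) (f : 'cV['Z_n]_d -> R)
  (xi : 'cV['Z_n]_d) : R[i] := \sum_x (f x)%:C%C * chi R (dot xi x).

Section ft.
Variables (R : realType) (n d : nat).
Hypothesis n1 : (1 < n)%N.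
Local Notation G := 'cV['Z_n]_d.
Implicit Types (f g : G -> R) (xi x y : G).
Let n0 : n%:R != 0 :> R. Proof. by rewrite pnatr_eq0; case: (n) n1. Qed.

Lemma sqr_normc_ft f xi : normc (ft f xi) ^+ 2 =
  \sum_x \sum_y f x * f y * complex.Re (chi R (dot xi (x - y))).
Proof.
rewrite sqr_normcE /ft conj_sum mulr_suml Re_sum; apply: eq_bigr => x _.
rewrite mulr_sumr Re_sum; apply: eq_bigr => y _.
rewrite conj_realM -chiN // mulrACA -rmorphM Re_realM.
by rewrite dotDr dotNr chiD.
Qed.

Lemma chi_nontrivial (x : 'Z_n) : x != 0 -> chi R x != 1.
Proof.
move=> x0; have cx0 : cent x != 0.
  by apply: contraNneq x0 => h; rewrite -(centK n1 x) h.
have np : 0 < n%:R :> R by rewrite lt0r n0 ler0n.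
have p0 : 0 < pi :> R := pi_gt0 R.
have n2 : 2 <= n%:R :> R by rewrite ler_nat.
have := @Re_chi_le R n n1 x n%:R^-1; rewrite invr_ge0 ler0n mulVf //.
have -> : 1 <= `|cent x|%:~R :> R.
  by rewrite -[1]/(1%:~R) ler_int; lia.
move=> /(_ isT isT) h; apply: contraTneq h => ->; rewrite -ltNge.
have i0 : 0 < n%:R^-1 :> R by rewrite invr_gt0.
have i1 : n%:R^-1 <= 2^-1 :> R by rewrite lef_pV2 ?posrE //; lra.
rewrite -[X in _ < X](cos0 R) ltr_cos ?in_itv /= ?lexx ?pi_ge0 //.
  by nra.
by apply/andP; split; nra.
Qed.

(** If y has a non-zero entry i, translating xi by the i-th basis vector
    multiplies the sum by chi (y_i), which is not 1. *)
Lemma sum_chi y :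
  \sum_(xi : G) chi R (dot xi y) = if y == 0 then #|{: G}|%:R else 0.
Proof.
case: eqVneq => [->|y0].
  rewrite (eq_bigr (fun _ => 1)); first by rewrite sumr_const.
  by move=> xi _; rewrite dot0r chi0.
have [i yi] : exists i, y i 0 != 0.
  apply/existsP; apply: contraNT y0; rewrite negb_exists => /forallP h.
  by apply/eqP/colP => i; rewrite mxE; apply/eqP; rewrite -[_ == _]negbK h.
set S := LHS; have : chi R (y i 0) * S = S.
  rewrite {2}/S (reindex_inj (addrI (delta_mx i 0))) /= mulr_sumr.
  by apply: eq_bigr => xi _; rewrite dotDl dot_delta chiD.
move/eqP; rewrite -subr_eq0 -[X in _ - X]mul1r -mulrBl mulf_eq0 subr_eq0.
by rewrite (negbTE (chi_nontrivial yi)) => /eqP.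
Qed.

Lemma plancherel f :
  \sum_xi normc (ft f xi) ^+ 2 = #|{: G}|%:R * \sum_x f x ^+ 2.
Proof.
under eq_bigr do rewrite sqr_normc_ft.
rewrite exchange_big mulr_sumr; apply: eq_bigr => x _.
rewrite exchange_big (bigD1 x) // [X in _ + X = _]big1 => [|y yx].
  rewrite -mulr_sumr -Re_sum sum_chi subrr eqxx.
  by rewrite Re_nat addr0 mulrC.
by rewrite -mulr_sumr -Re_sum sum_chi subr_eq0 eq_sym (negbTE yx) mulr0.
Qed.

Lemma normc_ft_le1 f xi : (forall x, 0 <= f x) -> \sum_x f x = 1 ->
  normc (ft f xi) ^+ 2 <= 1.
Proof.
move=> f0 f1; rewrite sqr_normc_ft.
apply: (@le_trans _ _ (\sum_x \sum_y f x * f y)).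
  apply: ler_sum => x _; apply: ler_sum => y _.
  by rewrite ler_piMr ?mulr_ge0 ?Re_chi_le1.
by under eq_bigr do rewrite -mulr_sumr f1 mulr1; rewrite f1.
Qed.

(** The upper bound lemma of Diaconis and Shahshahani: subtracting the
    uniform density from f kills the Fourier coefficient at 0 and leaves the
    others unchanged; Plancherel and Cauchy-Schwarz do the rest. *)
Lemma sum_deviation_le f (S : {set G}) : \sum_x f x = 1 ->
  (\sum_(x in S) f x - #|S|%:R / #|{: G}|%:R) ^+ 2 <=
  \sum_(xi | xi != 0) normc (ft f xi) ^+ 2.
Proof.
move=> f1; set m : R := #|{: G}|%:R.
have m0 : 0 < m by rewrite ltr0n; apply/card_gt0P; exists 0.
pose g x := f x - m^-1.
have -> : \sum_(x in S) f x - #|S|%:R / m = \sum_(x in S) g x.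
  by rewrite sumrB sumr_const mulr_natl.
have ft_g xi : ft g xi = ft f xi - (m^-1)%:C%C * \sum_x chi R (dot xi x).
  rewrite /ft mulr_sumr -sumrB; apply: eq_bigr => x _.
  by rewrite /g rmorphB mulrBl.
have ftg0 : ft g 0 = 0.
  rewrite /ft (eq_bigr (fun x => (g x)%:C%C)).
    rewrite -rmorph_sum /g sumrB f1 sumr_const -[#|_|]/#|{: G}| -mulr_natr.
    rewrite mulVf; first by rewrite subrr.
    by rewrite gt_eqF.
  by move=> x _; rewrite dotC dot0r chi0 // mulr1.
have ftgn xi : xi != 0 -> ft g xi = ft f xi.
  move=> xi0; rewrite ft_g (eq_bigr (fun x => chi R (dot x xi))).
    by rewrite sum_chi (negbTE xi0) mulr0 subr0.
  by move=> x _; rewrite dotC.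
have -> : \sum_(xi | xi != 0) normc (ft f xi) ^+ 2 = m * \sum_x g x ^+ 2.
  rewrite -plancherel [RHS](bigD1 0) //= ftg0 normc0 expr0n add0r.
  by apply: eq_bigr => xi xi0; rewrite ftgn.
set s := \sum_(x in S) g x.
(* Cauchy-Schwarz, by expanding the squares of g - s / m over S. *)
have h : \sum_(x in S) (g x - s / m) ^+ 2 <= \sum_x g x ^+ 2 - s ^+ 2 / m.
  apply: (@le_trans _ _ (\sum_(x in S) g x ^+ 2 - s ^+ 2 / m)); last first.
    rewrite lerD2r [leRHS](bigID (mem S)) /= lerDl sumr_ge0 // => x _.
    exact: sqr_ge0.
  under eq_bigr do rewrite sqrrB.
  rewrite big_split /= sumrB sumr_const sumrMnl -mulr_suml -/s -addrA lerD2l.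
  have hS : #|S|%:R <= m by rewrite ler_nat max_card.
  rewrite -[_ *+ #|S|]mulr_natr.
  have -> : (s / m) ^+ 2 * #|S|%:R = s ^+ 2 / m * (#|S|%:R / m).
    by field; rewrite gt_eqF.
  have h1 : s ^+ 2 / m * (#|S|%:R / m) <= s ^+ 2 / m.
    rewrite ler_piMr ?divr_ge0 ?sqr_ge0 ?(ltW m0) //.
    by rewrite ler_pdivrMr // mul1r.
  have -> : s * (s / m) = s ^+ 2 / m by rewrite mulrA expr2.
  by rewrite mulr2n; lra.
have : 0 <= \sum_(x in S) (g x - s / m) ^+ 2.
  by apply: sumr_ge0 => x _; apply: sqr_ge0.
move=> /le_trans/(_ h); rewrite subr_ge0 ler_pdivrMr //.
by rewrite [m * _]mulrC.
Qed.

End ft.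

(** * The law of the walk *)

Lemma measure_partition (R : realType) (dT : measure_display)
  (T : measurableType dT) (mu : {measure set T -> \bar R}) (X : finType)
  (D : set T) (f : T -> X) :
  measurable D -> (forall x, measurable (f @^-1` [set x])) ->
  mu D = (\sum_x mu (D `&` f @^-1` [set x]))%E.
Proof.
move=> mD mf.
have {1}-> : D = \bigcup_(x in [set` enum X]) (D `&` f @^-1` [set x]).
  apply/seteqP; split=> [w Dw|w [x _ [Dw _]]] //.
  by exists (f w) => //=; rewrite mem_enum.
rewrite measure_fin_bigcup //.
- by rewrite -fsbig_seq ?enum_uniq // big_enum.
- apply/trivIsetP => i j _ _ /eqP ij; apply/seteqP; split=> // w.
  by move=> [[_ /= hi] [_ /= hj]]; case: ij; rewrite -hi -hj.
- by move=> x _; apply: measurableI.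
Qed.

Section law.
Local Open Scope ereal_scope.
Variables (R : realType) (d : nat) (mu : probability 'cV[int]_d R).
Variables (A : 'M[int]_d) (dT : measure_display) (T : measurableType dT).
Variables (P : probability T R) (B : nat -> {RV P >-> 'cV[int]_d}).
Hypothesis hB : iid [set t : nat | (1 <= t)%N] B mu.
Variable n : nat.
Local Notation G := 'cV['Z_n]_d.

Let W t (w : T) : G := walk A n (fun s => B s w) t.
Let redn (b : 'cV[int]_d) : G := map_mx intr b.
Let An : 'M['Z_n]_d := map_mx intr A.

Let mB i (E : set 'cV[int]_d) : measurable (B i @^-1` E).
Proof. exact: measurable_funPTI. Qed.

Let WS t (x : G) : W t.+1 @^-1` [set x] =
  \bigcup_(y in [set` enum G])
    (W t @^-1` [set y] `&` B t.+1 @^-1` (redn @^-1` [set (x - An *m y)%R])).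
Proof.
apply/seteqP; split=> [w /= <-|w [y _ [/= <- h]]].
  exists (W t w); first by rewrite /= mem_enum.
  by split=> //=; rewrite /W /= -/An [X in (X - _)%R]addrC addrK.
by rewrite /W /= -/(W t w) -/(redn _) h -/An addrC subrK.
Qed.

Lemma measurable_walk t (x : G) : measurable (W t @^-1` [set x]).
Proof.
elim: t x => [|t IH] x.
  have [->|x0] := eqVneq x 0%R.
    by rewrite (_ : _ @^-1` _ = setT) //; apply/seteqP; split.
  rewrite (_ : _ @^-1` _ = set0) //; apply/seteqP; split=> // w /= h.
  by rewrite -h /W eqxx in x0.
rewrite WS bigcup_seq; apply: bigsetU_measurable => y _.
by apply: measurableI.
Qed.

Let measurable_bcap (J : seq nat) (E : nat -> set 'cV[int]_d) :
  measurable (\bigcap_(i in [set` J]) (B i @^-1` E i)).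
Proof. by apply: fin_bigcap_measurable => //; exact: finite_seq. Qed.

(** Independence of the walk at time t from the later increments. The
    statement allows any finite family of them, because the induction step
    transfers the increment of time t + 1 from the walk to that family. *)
Lemma walk_indep t (x : G) (J : seq nat) (E : nat -> set 'cV[int]_d) :
  uniq J -> (forall j, j \in J -> (t < j)%N) ->
  P (W t @^-1` [set x] `&` \bigcap_(i in [set` J]) (B i @^-1` E i)) =
  P (W t @^-1` [set x]) * \prod_(i <- J) P (B i @^-1` E i).
Proof.
have indep K F : uniq K -> (forall j, j \in K -> (0 < j)%N) ->
    P (\bigcap_(i in [set` K]) (B i @^-1` F i)) =
    \prod_(i <- K) P (B i @^-1` F i).
  by move=> uK K0; apply: hB.1 => // i /K0.
elim: t x J E => [|t IH] x J E uJ hJ.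
  have [->|x0] := eqVneq x 0%R.
    have -> : W 0 @^-1` [set 0%R] = setT by apply/seteqP; split.
    by rewrite setTI probability_setT mul1e indep.
  have -> : W 0 @^-1` [set x] = set0.
    by apply/seteqP; split=> // w /= h; rewrite -h /W eqxx in x0.
  by rewrite set0I measure0 mul0e.
pose Ex y := redn @^-1` [set (x - An *m y)%R].
have key K F : uniq K -> (forall j, j \in K -> (t.+1 < j)%N) ->
    P (W t.+1 @^-1` [set x] `&` \bigcap_(i in [set` K]) (B i @^-1` F i)) =
    \sum_y P (W t @^-1` [set y]) * P (B t.+1 @^-1` Ex y) *
      \prod_(i <- K) P (B i @^-1` F i).
  move=> uK hK.
  rewrite (measure_partition P (f := W t)); first last.
  - by move=> y; apply: measurable_walk.
  - by apply: measurableI; [apply: measurable_walk|apply: measurable_bcap].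
  apply: eq_bigr => y _.
  (* W t = y and W t.+1 = x together say W t = y and B t.+1 in Ex y. *)
  pose F' i := if i == t.+1 then Ex y else F i.
  have tK : t.+1 \notin K by apply/negP => /hK; rewrite ltnn.
  have eqF i : i \in K -> F' i = F i.
    by move=> iK; rewrite /F'; case: eqP => // e; rewrite -e iK in tK.
  have -> : (W t.+1 @^-1` [set x] `&`
        \bigcap_(i in [set` K]) (B i @^-1` F i)) `&` W t @^-1` [set y] =
      W t @^-1` [set y] `&` \bigcap_(i in [set` t.+1 :: K]) (B i @^-1` F' i).
    rewrite WS; apply/seteqP; split=> w.
      move=> [[[z _ [/= Wz hz]] hc] /= Wy]; split=> // i /=.
      rewrite inE => /predU1P[->|iK]; first by rewrite /F' eqxx /Ex /= -Wy Wz.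
      by rewrite /= eqF //; apply: hc.
    move=> [/= Wy hc]; split=> //; split.
      exists y => //=; first by rewrite mem_enum.
      split=> //; have := hc t.+1; rewrite /= inE eqxx /F' eqxx; exact.
    by move=> i /= iK; have := hc i; rewrite /= inE iK orbT eqF //; apply.
  apply: (etrans (IH y (t.+1 :: K) F' _ _)).
  - by rewrite /= tK.
  - by move=> j; rewrite inE => /predU1P[->//|/hK]; apply: ltnW.
  rewrite big_cons /F' eqxx muleA; congr (_ * _).
  by rewrite big_seq [RHS]big_seq; apply: eq_bigr => i iK; rewrite -/(F' i) eqF.
rewrite key // -ge0_sume_distrl; last by move=> y _; apply: mule_ge0.
congr (_ * _).
have := key [::] E isT; rewrite (_ : \bigcap_(i in _) _ = setT); last first.
  by apply/seteqP; split.
rewrite setIT => -> //; apply: eq_bigr => y _.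
by rewrite big_nil mule1.
Qed.

Lemma walk_step t (x : G) : P (W t.+1 @^-1` [set x]) =
  \sum_y P (W t @^-1` [set y]) * mu (redn @^-1` [set (x - An *m y)%R]).
Proof.
rewrite (measure_partition P (f := W t)); first last.
- by move=> y; apply: measurable_walk.
- exact: measurable_walk.
apply: eq_bigr => y _; pose E := redn @^-1` [set (x - An *m y)%R].
rewrite -(hB.2 t.+1 isT E) //.
have := @walk_indep t y [:: t.+1] (fun _ => E) isT.
rewrite big_seq1 => <-; last by move=> j; rewrite inE => /eqP->.
congr (P _); rewrite WS; apply/seteqP; split=> w.
  move=> [[z _ [/= Wz hz]] /= Wy]; split=> // i /=; rewrite inE => /eqP->.
  by rewrite /E /= -Wy Wz.
move=> [/= Wy hc]; split=> //; exists y => //=; first by rewrite mem_enum.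
split=> //; have := hc t.+1; rewrite /= inE eqxx; exact.
Qed.

End law.

Definition pmf_mod (R : realType) (d : nat) (mu : probability 'cV[int]_d R)
  (n : nat) (y : 'cV['Z_n]_d) : R := fine (mu (map_mx intr @^-1` [set y])).

(** Orbits of characters: <xi, A x> = <A^T xi, x>, so [A] moves characters
    by its transpose. *)
Definition orb (d : nat) (A : 'M[int]_d) (n : nat) (s : nat)
  (xi : 'cV['Z_n]_d) : 'cV['Z_n]_d := iter s (mulmx (map_mx intr A^T)) xi.

Section pmf.
Variables (R : realType) (d : nat) (mu : probability 'cV[int]_d R).
Variable n : nat.
Local Notation G := 'cV['Z_n]_d.

Lemma pmf_mod_ge0 (y : G) : 0 <= pmf_mod mu y.
Proof. by apply: fine_ge0. Qed.

Lemma pmf_mod_sum : \sum_(y : G) pmf_mod mu y = 1.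
Proof.
apply: EFin_inj; rewrite -sumEFin -(@probability_setT _ _ _ mu).
rewrite (measure_partition mu (f := map_mx intr : _ -> G)) //.
apply: eq_bigr => y _; rewrite setTI fineK //; exact: fin_num_measure.
Qed.

Lemma supp_gt0 x : supp mu x -> 0 < fine (mu [set x]).
Proof.
move=> hx; apply: fine_gt0; rewrite lt0e hx measure_ge0 /=.
by rewrite ltey_eq fin_num_measure.
Qed.

Lemma le_pmf_mod x : fine (mu [set x]) <= pmf_mod mu (map_mx intr x : G).
Proof.
apply: fine_le; rewrite ?fin_num_measure //.
by apply: le_measure; rewrite ?inE // => _ /= ->.
Qed.

End pmf.

Section walk_law.
Variables (R : realType) (d : nat) (mu : probability 'cV[int]_d R).
Variables (A : 'M[int]_d) (dT : measure_display) (T : measurableType dT).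
Variables (P : probability T R) (B : nat -> {RV P >-> 'cV[int]_d}).
Hypothesis hB : iid [set t : nat | (1 <= t)%N] B mu.
Variable n : nat.
Hypothesis n1 : (1 < n)%N.
Local Notation G := 'cV['Z_n]_d.
Let An : 'M['Z_n]_d := map_mx intr A.
Let W t (w : T) : G := walk A n (fun s => B s w) t.

Definition walk_pmf t (x : G) : R := fine (P (W t @^-1` [set x])).

Let mW t (x : G) : measurable (W t @^-1` [set x]).
Proof. exact: measurable_walk. Qed.

Lemma finlaw_walk t (S : {set G}) :
  finlaw P (W t) S = \sum_(x in S) walk_pmf t x.
Proof.
have mS : measurable [set w | W t w \in S].
  rewrite (_ : [set w | _] = \bigcup_(y in [set` enum S]) (W t @^-1` [set y])).
    by rewrite bigcup_seq; apply: bigsetU_measurable => y _; exact: mW.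
  apply/seteqP; split=> [w /= hw|w [y /= hy e]]; last first.
    by rewrite mem_enum in hy; rewrite e.
  by exists (W t w) => //=; rewrite mem_enum.
apply: EFin_inj; rewrite fineK ?fin_num_measure // -sumEFin big_mkcond /=.
rewrite (measure_partition P (f := W t)) //.
apply: eq_bigr => x _; case: ifPn => xS.
  rewrite fineK ?fin_num_measure //; congr (P _).
  by apply/seteqP; split=> [w [_ //]|w /= e]; split=> //=; rewrite e.
rewrite (_ : _ `&` _ = set0) ?measure0 //; apply/seteqP; split=> // w [/= h e].
by rewrite -e h in xS.
Qed.

Lemma walk_pmf_sum t : \sum_x walk_pmf t x = 1.
Proof.
apply: EFin_inj; rewrite -sumEFin -(@probability_setT _ _ _ P).
rewrite (measure_partition P (f := W t)) //.
by apply: eq_bigr => y _; rewrite setTI fineK ?fin_num_measure.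
Qed.

Lemma walk_pmfS t x :
  walk_pmf t.+1 x = \sum_y walk_pmf t y * pmf_mod mu (x - An *m y).
Proof.
apply: EFin_inj; rewrite fineK ?fin_num_measure // (walk_step A hB) -sumEFin.
by apply: eq_bigr => y _; rewrite EFinM !fineK ?fin_num_measure.
Qed.

Lemma walk_pmf0 x : walk_pmf 0 x = (x == 0)%:R.
Proof.
rewrite /walk_pmf; case: eqVneq => [->|x0].
  rewrite (_ : _ @^-1` _ = setT) ?probability_setT //.
  by apply/seteqP; split.
rewrite (_ : _ @^-1` _ = set0) ?measure0 //; apply/seteqP; split=> // w /= h.
by rewrite -h /W eqxx in x0.
Qed.

(** A step of the walk applies [A] to the position, that is, the transpose
    of [A] to the character, and then convolves with [mu] modulo n. *)
Lemma ft_walk t xi :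
  ft (walk_pmf t) xi = \prod_(s < t) ft (pmf_mod mu (n := n)) (orb A s xi).
Proof.
elim: t xi => [|t IH] xi.
  rewrite big_ord0 /ft (bigD1 0) //= walk_pmf0 eqxx mul1r dot0r chi0 //.
  by rewrite big1 ?addr0 // => x x0; rewrite walk_pmf0 (negbTE x0) mul0r.
rewrite big_ord_recl.
have -> : ft (walk_pmf t.+1) xi =
    ft (pmf_mod mu (n := n)) xi * ft (walk_pmf t) (map_mx intr A^T *m xi).
  rewrite mulrC /ft mulr_suml.
  under eq_bigr do rewrite walk_pmfS rmorph_sum mulr_suml.
  rewrite exchange_big; apply: eq_bigr => y _.
  rewrite mulr_sumr (reindex_inj (addIr (An *m y))).
  apply: eq_bigr => x _; rewrite addrK rmorphM dotDr chiD //.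
  rewrite dot_mul -map_trmx /=.
  set u := chi _ _; set v := chi _ _; set p := (walk_pmf _ _)%:C%C.
  set q := (pmf_mod _ _)%:C%C.
  by ring.
congr (_ * _); rewrite IH; apply: eq_bigr => s _; congr (ft _ _).
by rewrite /orb [RHS]iterSr.
Qed.

End walk_law.

(** * Spectral gaps *)

(** The proportion of |ft f xi|^2 that is lost when f is convolved with [mu]
    modulo n. *)
Definition gap (R : realType) (d : nat) (mu : probability 'cV[int]_d R)
  (n : nat) (xi : 'cV['Z_n]_d) : R :=
  1 - normc (ft (pmf_mod mu (n := n)) xi) ^+ 2.

Section gap.
Variables (R : realType) (d : nat) (mu : probability 'cV[int]_d R).
Variable A : 'M[int]_d.

Lemma gap_ge0 n (xi : 'cV['Z_n]_d) : (1 < n)%N -> 0 <= gap mu xi.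
Proof.
move=> n1; rewrite subr_ge0 normc_ft_le1 // => [x|].
  exact: pmf_mod_ge0.
exact: pmf_mod_sum.
Qed.

(** The gap is the mean of 1 - cos over the pairs of independent increments,
    so it is at least the contribution of a single pair. *)
Lemma gap_atoms n (xi : 'cV['Z_n]_d) x y : (1 < n)%N ->
  fine (mu [set x]) * fine (mu [set y]) *
    (1 - complex.Re (chi R (dot xi (map_mx intr (x - y))))) <= gap mu xi.
Proof.
move=> n1; pose p := pmf_mod mu (n := n).
have p0 z : 0 <= p z := pmf_mod_ge0 mu z.
have -> : gap mu xi =
    \sum_a \sum_b p a * p b * (1 - complex.Re (chi R (dot xi (a - b)))).
  rewrite /gap sqr_normc_ft // -/p.
  have e1 : \sum_a \sum_b p a * p b = 1.
    under eq_bigr do rewrite -mulr_sumr (pmf_mod_sum mu n) mulr1.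
    exact: pmf_mod_sum.
  rewrite -[X in X - _]e1 -sumrB; apply: eq_bigr => a _.
  rewrite -sumrB; apply: eq_bigr => b _; by rewrite [RHS]mulrBr mulr1.
have r0 z : 0 <= 1 - complex.Re (chi R z) by rewrite subr_ge0 (Re_chi_le1 R z).
rewrite (bigD1 (map_mx intr x)) //= (bigD1 (map_mx intr y)) //= -addrA.
apply: ler_wpDr.
  rewrite addr_ge0 // ?sumr_ge0 // => a _; rewrite ?sumr_ge0 // => *.
    by rewrite mulr_ge0 ?mulr_ge0 ?r0.
  by rewrite mulr_ge0 ?mulr_ge0 ?r0.
rewrite map_mxB; apply: ler_wpM2r; first exact: r0.
by apply: ler_pM; rewrite ?fine_ge0 ?le_pmf_mod.
Qed.

(** The constants J and K depend on neither the modulus nor the character.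
    Being controlled is stable under all the operations that generate the
    invariant hull, which is why the whole hull can be treated at once. *)
Definition controlled (h : 'cV[int]_d) : Prop :=
  exists (J : nat) (K : R), 0 <= K /\
    forall n (xi : 'cV['Z_n]_d), (1 < n)%N ->
      1 - complex.Re (chi R (dot xi (map_mx intr h))) <=
      K * \sum_(j < J) gap mu (orb A j xi).

(** For unit complex numbers 1 - Re z = |1 - z|^2 / 2 and |1 - z w^*| = |z -
    w|, so this is |x - y|^2 <= 2 |x|^2 + 2 |y|^2 with x = 1 - z and y = 1 -
    w. *)
Lemma one_sub_ReB (z w : R[i]) : normc z ^+ 2 = 1 -> normc w ^+ 2 = 1 ->
  1 - complex.Re (z * w^*%C) <=
  2 * (1 - complex.Re z) + 2 * (1 - complex.Re w).
Proof.
case: z w => [c s] [c' s'] /=.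
rewrite !sqr_sqrtr ?addr_ge0 ?sqr_ge0 // => h1 h2.
(* |x + y|^2 is twice the difference of the two sides. *)
have := addr_ge0 (sqr_ge0 (c + c' - 2)) (sqr_ge0 (s + s')); nra.
Qed.

Lemma gap_sum_le n (xi : 'cV['Z_n]_d) (J J' : nat) : (1 < n)%N -> (J <= J')%N ->
  \sum_(j < J) gap mu (orb A j xi) <= \sum_(j < J') gap mu (orb A j xi).
Proof.
move=> n1 JJ; rewrite -(subnKC JJ) big_split_ord /= lerDl.
by apply: sumr_ge0 => j _; apply: gap_ge0.
Qed.

Lemma controlled_subgroup : subgroup [set h | controlled h].
Proof.
split=> [|x y]; rewrite !in_setE.
  exists 0%N, 0; split=> // n xi n1.
  by rewrite map_mx0 dot0r chi0 // mul0r subrr.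
move=> [J1 [K1 [K10 h1]]] [J2 [K2 [K20 h2]]].
exists (maxn J1 J2), (2 * K1 + 2 * K2); split.
  by rewrite addr_ge0 // mulr_ge0.
move=> n xi n1; rewrite map_mxB dotDr dotNr chiD // chiN //.
apply: (le_trans (one_sub_ReB _ _)); rewrite ?normc_chi ?expr1n //.
rewrite [leRHS]mulrDl -!mulrA; apply: lerD; rewrite ler_pM2l //.
  apply: (le_trans (h1 _ _ n1)); rewrite ler_wpM2l // gap_sum_le // leq_maxl//.
apply: (le_trans (h2 _ _ n1)); rewrite ler_wpM2l // gap_sum_le // leq_maxr//.
Qed.

(** Replacing h by A h amounts to moving [xi] one step along its orbit. *)
Lemma controlled_invariant : mx_invariant A [set h | controlled h].
Proof.
move=> h [J [K [K0 hJ]]]; exists J.+1, K; split=> // n xi n1.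
rewrite map_mxM dot_mul map_trmx.
apply: (le_trans (hJ _ _ n1)); rewrite ler_wpM2l // big_ord_recl.
rewrite ler_wpDl ?gap_ge0 //; apply: ler_sum => j _.
by rewrite /orb -iterSr.
Qed.

Lemma hull_controlled h :
  invariant_hull A [set x - y | x in supp mu & y in supp mu] h -> controlled h.
Proof.
move/(_ [set h | controlled h]); apply; split.
  by split; [exact: controlled_subgroup|exact: controlled_invariant].
move=> _ [x hx [y hy <-]] /=.
have mx := supp_gt0 hx; have my := supp_gt0 hy.
exists 1%N, (fine (mu [set x]) * fine (mu [set y]))^-1; split.
  by rewrite invr_ge0 mulr_ge0 // ltW.
move=> n xi n1; rewrite big_ord1 ler_pdivlMl ?mulr_gt0 //.
exact: gap_atoms.
Qed.

End gap.

(** A common multiple of the a_i annihilates the quotient of Z^d by [H]; it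
    is invertible modulo n as soon as n is coprime with the a_i. *)
Lemma generated_smul (d : nat) (u : 'I_d -> 'cV[int]_d) (a : 'I_d -> nat) x :
  Zbasis u -> generated (range (fun i => u i *+ a i)) (x *+ \prod_i a i).
Proof.
move=> hu; set H := generated _; set m := \prod_i a i.
have H0 : H 0 by move=> S [[S0 _] _]; rewrite inE in S0.
have Hsub y z : H y -> H z -> H (y - z).
  move=> hy hz S hS; have := hS.1.2 y z; rewrite !inE.
  by apply; [exact: hy|exact: hz].
have Hmul y k : H y -> H (y *+ k).
  move=> hy; elim: k => [|k IH]; first by rewrite mulr0n.
  rewrite mulrSr -[X in _ + X]opprK; apply: (Hsub) => //.
  by rewrite -[- y]sub0r; apply: Hsub.
have : generated (range u) x by rewrite hu.
move/(_ [set y | H (y *+ m)]); apply; split.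
  split=> [|y z]; rewrite !inE /= ?mul0rn // mulrnBl; exact: Hsub.
move=> _ [i _ <-] /=; rewrite /m (bigD1 i) //= mulrnA; apply: Hmul.
by move=> S hS; apply: hS.2; exists i.
Qed.

(** * Symbolic coding of orbits *)

Definition mxsize (d : nat) (M : 'M[int]_d) : nat := \sum_i \sum_j `|M i j|%N.

Lemma mulmx_bound (d : nat) (M : 'M[int]_d) (x : 'cV[int]_d) (k N : int) i :
  0 <= k -> 0 <= N -> (forall j, k * `|x j 0| <= N) ->
  k * `|(M *m x) i 0| <= (mxsize M)%:Z * N.
Proof.
move=> k0 N0 hx; rewrite mxE.
apply: (@le_trans _ _ (\sum_j `|M i j| * N)).
  apply: (@le_trans _ _ (k * \sum_j `|M i j * x j 0|)).
    by rewrite ler_wpM2l // ler_norm_sum.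
  rewrite mulr_sumr; apply: ler_sum => j _.
  by rewrite normrM mulrCA ler_wpM2l.
rewrite -mulr_suml ler_wpM2r //.
rewrite (_ : \sum_j `|M i j| = (\sum_j `|M i j|%N)%N%:Z).
  by rewrite lez_nat /mxsize [leqRHS](bigD1 i) //= leq_addr.
rewrite (big_morph Posz PoszD (erefl _)).
by apply: eq_bigr => j _; rewrite abszE.
Qed.

Section code.
Variables (d : nat) (A : 'M[int]_d) (a n : nat).
Hypothesis n1 : (1 < n)%N.
Local Notation G := 'cV['Z_n]_d.
Let b := (mxsize A^T).+1.

(** The coordinates of a.xi, unlike those of [xi], are controlled by the
    gaps, because the hull contains a.Z^d but may be smaller than Z^d. *)
Definition lift_mod (xi : G) : 'cV[int]_d := map_mx (@cent n) (xi *+ a).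

(** How far the lifts are from an orbit of A^T in Z^d; a multiple of n. *)
Definition carry (xi : G) : 'cV[int]_d :=
  A^T *m lift_mod xi - lift_mod (orb A 1 xi).

(** The digit of [xi] is [carry xi / n]. It is only kept modulo a number
    larger than its range of values, which gives a finite alphabet
    independent of n without losing information; see [code_inj_carry]. *)
Definition code (xi : G) : 'cV['Z_(mxsize A^T).+2]_d :=
  map_mx intr (map_mx (fun z => (z %/ n)%Z) (carry xi)).

Lemma codeE xi i : code xi i 0 = (carry xi i 0%R %/ n)%Z%:~R.
Proof. by rewrite /code mxE [X in X%:~R]mxE. Qed.

Lemma lift_modK xi : map_mx intr (lift_mod xi) = xi *+ a.
Proof. by apply/colP => i; rewrite !mxE centK. Qed.

Lemma lift_mod_le xi i : 2 * `|lift_mod xi i 0| <= n%:Z.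
Proof. by rewrite mxE cent_le. Qed.

Lemma map_mul_lift xi :
  map_mx intr (A^T *m lift_mod xi) = (orb A 1 xi) *+ a :> G.
Proof. by rewrite map_mxM lift_modK /orb /= raddfMn. Qed.

Lemma dvd_carry xi i : (n %| carry xi i 0%R)%Z.
Proof.
rewrite -intr_Zp_eq0 // mxE [X in _ + X]mxE intrB subr_eq0.
have /colP/(_ i) := map_mul_lift xi; rewrite [X in X = _]mxE => ->.
by rewrite -lift_modK [X in X == _]mxE.
Qed.

Lemma carry_le xi i : 2 * `|carry xi i 0| <= b%:Z * n%:Z.
Proof.
have h := @mulmx_bound _ A^T (lift_mod xi) 2 n%:Z i isT isT (lift_mod_le xi).
have h' := lift_mod_le (orb A 1 xi) i.
rewrite mxE [X in _ + X]mxE.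
move: (fun_of_matrix _ i 0) h (fun_of_matrix _ i 0) h' => x h y h'.
rewrite (_ : b%:Z = (mxsize A^T)%:Z + 1); last by rewrite /b; lia.
rewrite [leRHS]mulrDl mul1r.
by move: (_ * n%:Z) h => z h; lia.
Qed.

(** The entries of a digit are at most b / 2 in absolute value, so two of
    them differ by less than the modulus b + 1. *)
Lemma code_inj_carry xi xi' : code xi = code xi' -> carry xi = carry xi'.
Proof.
move=> /colP h; apply/colP => i; have := h i; rewrite !codeE => /eqP.
rewrite -subr_eq0 -intrB intr_Zp_eq0 // => /dvdzP[q hq].
have /dvdzP[u hu] := dvd_carry xi i; have /dvdzP[v hv] := dvd_carry xi' i.
have n0 : n%:Z != 0 by case: (n) n1.
have bu := carry_le xi i; have bv := carry_le xi' i.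
move: hq bu bv; rewrite hu hv !mulzK // => hq bu bv.
rewrite !normrM !mulrA !ler_pM2r ?normr_gt0 // in bu bv.
suff -> : u = v by [].
have q0 : q = 0 by rewrite /b in bu bv; nia.
by apply/eqP; rewrite -subr_eq0 hq q0 mul0r.
Qed.

(** If all the entries of the lift are small compared to n, those of its
    image by A^T are less than n / 2, so the image is again a lift and the
    digit is 0. *)
Lemma code_neq0 xi : code xi != 0 ->
  exists i, n%:Z < 2 * b%:Z * `|cent ((xi *+ a) i 0)|.
Proof.
move=> c0; apply: contrapT => /forallNP h; case/eqP: c0.
suff -> : code xi = map_mx intr (map_mx (fun z => (z %/ n)%Z) (0 : 'cV[int]_d)).
  by apply/colP => i; rewrite !mxE div0z.
congr (map_mx _ (map_mx _ _)); apply/eqP; rewrite subr_eq0; apply/eqP/colP => i.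
have hb : forall j, 2 * b%:Z * `|lift_mod xi j 0| <= n%:Z.
  by move=> j; rewrite mxE leNgt; apply/negP/h.
have := @mulmx_bound _ A^T (lift_mod xi) (2 * b%:Z) n%:Z i isT isT hb.
move: (map_mul_lift xi) => /colP/(_ i); rewrite [X in X = _]mxE => e.
move: (A^T *m _) e => x e hx; rewrite [RHS]mxE -e cent_int //.
rewrite ltNge; apply/negP => hn.
have : b%:Z * n%:Z <= b%:Z * (2 * `|x i 0|) by rewrite ler_wpM2l.
rewrite mulrA [b%:Z * 2]mulrC => /le_trans/(_ hx).
by rewrite ler_pM2r ?lez_nat ?ltnn // ltz_nat; case: (n) n1.
Qed.

End code.

Lemma code0 (d : nat) (A : 'M[int]_d) (a n : nat) : (1 < n)%N ->
  code A a (0 : 'cV['Z_n]_d) = 0.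
Proof.
move=> n1; apply/eqP; apply: contraT => /(code_neq0 n1) => -[j].
rewrite mul0rn mxE (_ : cent 0 = 0) ?normr0 ?mulr0 //.
by apply: (cent_int n1 (m := 0)); rewrite normr0 mulr0 ltz_nat ltnW.
Qed.

(** If two characters have the same digits, the differences of their lifts
    form an orbit of A^T in Z^d bounded by n, to which hyperbolicity
    applies. *)
Lemma code_separates (R : realType) (d : nat) (A : 'M[int]_d.+1) :
  A \in unitmx -> hyperbolic R A ->
  exists c : nat, forall (a n : nat) (xi xi' : 'cV['Z_n]_d.+1),
    (1 < n)%N -> coprime n a ->
    (forall s, (s < c * (trunc_log 2 n).+1)%N ->
      code A a (orb A s xi) = code A a (orb A s xi')) -> xi = xi'.
Proof.
move=> hA /(hyperbolic_orbit_vanish hA)[c hc]; exists c => a n xi xi' n1 na hs.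
pose Y s := lift_mod a (orb A s xi) - lift_mod a (orb A s xi').
have YS s : (s <= c * (trunc_log 2 n).+1)%N -> A^T ^+ s *m Y 0%N = Y s.
  elim: s => [|s IH] hsc; first by rewrite expr0 mul1mx.
  rewrite exprS -mulmxE -mulmxA IH ?(ltnW hsc) // /Y mulmxBr.
  have := code_inj_carry n1 (hs _ hsc); rewrite /carry => /eqP.
  rewrite subr_eq addrAC -subr_eq opprK addrC => /eqP e.
  apply/eqP; rewrite subr_eq addrAC -subr_eq; apply/eqP.
  by rewrite opprK -e addrC.
have Y0 : Y 0%N = 0.
  apply: (hc n) => s hsc i; rewrite YS // /Y.
  have h1 := lift_mod_le a n1 (orb A s xi) i.
  have h2 := lift_mod_le a n1 (orb A s xi') i.
  rewrite mxE [X in _ + X]mxE.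
  by move: (lift_mod _ _ i 0) (lift_mod _ _ i 0) h1 h2 => u v h1 h2; lia.
have : xi *+ a = xi' *+ a.
  rewrite -!lift_modK //; congr (map_mx _ _); apply/eqP.
  by rewrite -subr_eq0 -/(Y 0%N) Y0.
move=> /colP e; apply/colP => i; have := e i; rewrite !mulmxnE.
rewrite -[LHS]mulr_natr -[RHS]mulr_natr.
by apply: mulIr; rewrite unitZpE.
Qed.

(** * Summing over the codes *)

(** Distinct elements have distinct words, none of which is constantly z, so
    the left-hand side is a partial sum of the weights of all the other
    words; and the total weight of all the words is a product. *)
Lemma sum_code_weight (R : realFieldType) (X C : finType) (z : C) (m : nat)
  (f : X -> 'I_m -> C) (D : {set X}) (th : R) : 0 <= th ->
  {in D &, forall x y, (forall s, f x s = f y s) -> x = y} ->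
  (forall x, x \in D -> exists s, f x s != z) ->
  \sum_(x in D) \prod_(s < m) (if f x s == z then 1 else th) <=
  (1 + #|C|%:R * th) ^+ m - 1.
Proof.
move=> th0 finj fz.
pose F x := [ffun s => f x s]; pose z0 : {ffun 'I_m -> C} := [ffun=> z].
pose v c : R := if c == z then 1 else th.
pose w (g : {ffun 'I_m -> C}) := \prod_s v (g s).
have v0 c : 0 <= v c by rewrite /v; case: ifP.
have w0 g : 0 <= w g by apply: prodr_ge0.
have Finj : {in D &, injective F}.
  move=> x y xD yD /ffunP h; apply: finj => // s.
  by have := h s; rewrite !ffunE.
rewrite (eq_bigr (fun x => w (F x))); last first.
  by move=> x _; apply: eq_bigr => s _; rewrite ffunE.
rewrite -(big_imset w Finj) /=.
have -> : (1 + #|C|%:R * th) ^+ m = \prod_(s < m) (1 + #|C|%:R * th).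
  by rewrite prodr_const card_ord.
rewrite lerBrDl; apply: (@le_trans _ _ (\sum_g w g)); last first.
  rewrite /w -(bigA_distr_bigA (fun _ c => v c)).
  apply: ler_prod => s _; rewrite sumr_ge0 //= (bigD1 z) //=.
  rewrite {1}/v eqxx lerD2l (eq_bigr (fun => th)); last first.
    by move=> c cz; rewrite /v (negbTE cz).
  rewrite sumr_const -[th *+ _]mulr_natl ler_wpM2r // ler_nat; exact: max_card.
rewrite [leRHS](bigD1 z0) //=.
have -> : w z0 = 1 by rewrite /w big1 // => s _; rewrite ffunE /v eqxx.
rewrite lerD2l [leRHS](bigID (mem (F @: D))) /=.
rewrite ler_wpDr ?sumr_ge0 //.
rewrite [leLHS](eq_bigl (fun g => (g != z0) && (g \in F @: D))) // => g.
rewrite andbC; case: imsetP => // -[x xD ->]; rewrite andTb; symmetry.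
have [s fs] := fz x xD; apply: contra_neq fs => /ffunP/(_ s).
by rewrite !ffunE.
Qed.

Lemma prod_le_mean (R : realFieldType) (r : nat) (x : 'I_r -> R) : (0 < r)%N ->
  (forall i, 0 <= x i) -> \prod_i x i <= r%:R^-1 * \sum_i x i ^+ r.
Proof.
move=> r0 x0.
have [h _] := @leif_AGM R 'I_r predT (fun i => x i ^+ r)
  (fun i _ => exprn_ge0 _ (x0 i)).
rewrite mulrC -(@ler_pXn2r _ r) ?nnegrE ?prodr_ge0 //.
  by rewrite -prodrXl; move: h; rewrite card_ord.
by rewrite mulr_ge0 ?invr_ge0 ?ler0n ?sumr_ge0 // => i _; rewrite exprn_ge0.
Qed.

Section mixing.
Variables (R : realType) (d : nat) (mu : probability 'cV[int]_d R).
Variable A : 'M[int]_d.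

Lemma orb_inj n s : A \in unitmx -> injective (@orb d A n s).
Proof.
move=> hA; elim: s => [|s IH] // x y; rewrite /orb !iterS => h; apply: IH.
have uM : (map_mx intr A^T : 'M['Z_n]_d) \in unitmx.
  by rewrite unitmxE det_map_mx rmorph_unit // -unitmxE unitmx_tr.
by rewrite /orb -[LHS](mulKmx uM) h mulKmx.
Qed.

Lemma orb0 n s : @orb d A n s 0 = 0.
Proof. by elim: s => // s; rewrite /orb iterS => ->; rewrite mulmx0. Qed.

Lemma orbD n s t xi : @orb d A n (s + t) xi = orb A s (orb A t xi).
Proof. by rewrite /orb iterD. Qed.

Variable a : nat.
Hypothesis ha : forall h : 'cV[int]_d, controlled mu A (h *+ a).

Lemma controlled_coords : exists (J : nat) (K : R), 0 <= K /\
  forall n (xi : 'cV['Z_n]_d) i, (1 < n)%N ->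
    1 - complex.Re (chi R ((xi *+ a) i 0)) <=
    K * \sum_(j < J) gap mu (orb A j xi).
Proof.
have /choice[J hJ] i := ha (delta_mx i 0); have /choice[K hK] := hJ.
exists (\max_i J i), (\sum_i K i); split.
  by apply: sumr_ge0 => i _; have [] := hK i.
move=> n xi i n1; have [K0 /(_ n xi n1)] := hK i.
have -> : dot xi (map_mx intr (delta_mx i 0 *+ a)) = (xi *+ a) i 0.
  by rewrite raddfMn /= map_delta_mx dotMnr dotC dot_delta mulmxnE.
move/le_trans; apply; apply: ler_pM => //.
- by apply: sumr_ge0 => j _; apply: gap_ge0.
- by rewrite (bigD1 i) //= lerDl sumr_ge0 // => k _; have [] := hK k.
- by apply: gap_sum_le => //; apply: leq_bigmax.
Qed.

(** A non-zero digit provides a coordinate of a.xi at distance of order n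
    from 0, where [chi] is bounded away from 1; that coordinate is
    controlled. *)
Lemma gap_code : exists (J : nat) (e : R), 0 < e /\
  forall n (xi : 'cV['Z_n]_d), (1 < n)%N ->
    code A a xi != 0 -> e <= \sum_(j < J) gap mu (orb A j xi).
Proof.
have [J [K [K0 hK]]] := controlled_coords.
set b : R := 2 * (mxsize A^T).+1%:R.
have b2 : 2 <= b by rewrite /b ler_peMr // ler1n.
have bp : 0 < b by apply: lt_le_trans b2.
have p0 : 0 < pi :> R := pi_gt0 R.
pose c := cos (2 * pi * b^-1).
have b1 : 2 * b^-1 <= 1 by rewrite ler_pdivrMr ?mul1r.
have bi : 0 < b^-1 by rewrite invr_gt0.
have c1 : c < 1.
  rewrite -[ltRHS](cos0 R) /c ltr_cos ?in_itv /= ?lexx ?pi_ge0 //; last first.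
    by apply/andP; split; nra.
  by rewrite !mulr_gt0.
exists J, ((1 - c) / (K + 1)); split.
  by rewrite divr_gt0 ?subr_gt0 // ltr_wpDl.
move=> n xi n1 /(code_neq0 n1)[j hj].
rewrite ler_pdivrMr ?ltr_wpDl //.
have h : b^-1 * n%:R <= `|cent ((xi *+ a) j 0)|%:~R.
  rewrite ler_pdivrMl // /b -[2]/(2%:~R) -![_%:R]/(_%:Z%:~R) -!intrM ler_int.
  exact: ltW.
have := @Re_chi_le R n n1 ((xi *+ a) j 0) b^-1 (ltW bi) h; rewrite -/c => hc.
have := hK n xi j n1; set S := \sum_(_ < _) _ => hS.
have S0 : 0 <= S by apply: sumr_ge0 => k _; apply: gap_ge0.
by lra.
Qed.

End mixing.

Lemma normc_prod (R : rcfType) (I : finType) (F : I -> R[i]) :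
  normc (\prod_i F i) = \prod_i normc (F i).
Proof. by apply: (big_morph _ (@normcM R) (@normc1 R)). Qed.

(** Each g s is counted at most J times on the left. *)
Lemma sum_window_le (R : realFieldType) (g : nat -> R) (N J t : nat) :
  (forall s, 0 <= g s) -> (N + J <= t)%N ->
  \sum_(s < N) \sum_(j < J) g (s + j)%N <= J%:R * \sum_(s < t) g s.
Proof.
move=> g0 hN; rewrite exchange_big /=.
apply: (@le_trans _ _ (\sum_(j < J) \sum_(s < t) g s)); last first.
  by rewrite sumr_const card_ord [leRHS]mulr_natl.
apply: ler_sum => j _.
rewrite -(big_mkord xpredT g) -(big_mkord xpredT (fun s => g (s + j)%N)).
have -> : \sum_(0 <= s < N) g (s + j)%N = \sum_(j <= s < N + j) g s.
  by rewrite -{2}[j : nat]add0n big_addn addnK.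
rewrite (@big_cat_nat _ _ _ j 0 t) //=; last by have := ltn_ord j; lia.
rewrite (@big_cat_nat _ _ _ (N + j) j t) //=; try by have := ltn_ord j; lia.
rewrite ler_wpDl ?sumr_ge0 // ler_wpDr ?sumr_ge0 //.
Qed.

Lemma prod_blocks (R : comPzRingType) (g : nat -> R) (r m : nat) :
  \prod_(s < r * m) g s = \prod_(i < r) \prod_(s < m) g (s + i * m)%N.
Proof.
elim: r => [|r IH]; first by rewrite mul0n !big_ord0.
rewrite big_ord_recr -IH mulSnr big_split_ord /=; congr (_ * _).
by apply: eq_bigr => s _; rewrite addnC.
Qed.

Section mixing_bound.
Variables (R : realType) (d : nat) (mu : probability 'cV[int]_d.+1 R).
Variable A : 'M[int]_d.+1.
Variables (dT : measure_display) (T : measurableType dT).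
Variables (P : probability T R) (B : nat -> {RV P >-> 'cV[int]_d.+1}).
Hypothesis hB : iid [set t : nat | (1 <= t)%N] B mu.
Variable a : nat.
Hypothesis ha : forall h : 'cV[int]_d.+1, controlled mu A (h *+ a).

(** Since 1 - g <= exp (- g), the product of the coefficients along the
    orbit is at most the exponential of minus the sum of the gaps. Every
    non-zero digit brings e to the sum of the gaps over a window of length J
    + 1, and each gap lies in at most J + 1 windows, whence th = exp (- e /
    (J + 1)). *)
Lemma ft_walk_le : exists (J : nat) (th : R), [/\ 0 < th, th < 1 &
  forall n (xi : 'cV['Z_n]_d.+1) N t, (1 < n)%N -> (N + J <= t)%N ->
    normc (ft (walk_pmf A B t) xi) ^+ 2 <=
    \prod_(s < N) (if code A a (orb A s xi) == 0 then 1 else th)].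
Proof.
have [J [e [e0 he]]] := gap_code ha.
have J0 : 0 < J.+1%:R :> R by rewrite ltr0n.
exists J.+1, (expR (- (e / J.+1%:R))); split; first exact: expR_gt0.
  by rewrite expR_lt1 oppr_lt0 divr_gt0.
move=> n xi N t n1 hN; pose g s := gap mu (orb A s xi).
have g0 s : 0 <= g s by apply: gap_ge0.
have -> : normc (ft (walk_pmf A B t) xi) ^+ 2 = \prod_(s < t) (1 - g s).
  rewrite (ft_walk A hB n1) normc_prod -prodrXl; apply: eq_bigr => s _.
  by rewrite /g /gap subKr.
apply: (@le_trans _ _ (expR (- \sum_(s < t) g s))).
  rewrite -sumrN expR_sum; apply: ler_prod => s _.
  rewrite expR_ge1Dx andbT /g /gap subKr; exact: sqr_ge0.
pose f s := if code A a (orb A s xi) == 0 then 0 else e / J.+1%:R.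
have -> : \prod_(s < N) (if code A a (orb A s xi) == 0 then 1
    else expR (- (e / J.+1%:R))) = expR (- \sum_(s < N) f s).
  rewrite -sumrN expR_sum; apply: eq_bigr => s _.
  by rewrite /f; case: ifP => // _; rewrite oppr0 expR0.
rewrite ler_expR lerN2 -(ler_pM2l J0).
apply: le_trans (sum_window_le g0 hN); rewrite mulr_sumr.
apply: ler_sum => s _; rewrite /f; case: ifPn => [_|hs].
  by rewrite mulr0 sumr_ge0.
rewrite mulrC divfK ?gt_eqF //; apply: (le_trans (he _ _ n1 hs)).
rewrite big_ord_recr /= ler_wpDr // le_eqVlt; apply/orP; left; apply/eqP.
by apply: eq_bigr => j _; rewrite /g -orbD addnC.
Qed.

Hypothesis hA : A \in unitmx.
Hypothesis hyp : hyperbolic R A.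

(** The weight of the first r blocks of digits of [xi] is the product of the
    weights F of single blocks at r points of its orbit, so it is at most
    the mean of the r-th powers F^r at these points. Moving along the orbit
    permutes the non-zero characters; so, in the sum over [xi], all the
    points contribute the same as [xi] itself. *)
Lemma fourier_bound : exists (Q c J : nat) (th : R), [/\ 0 < th, th < 1 &
  forall n r t, (1 < n)%N -> coprime n a -> (0 < r)%N ->
    (r * (c * (trunc_log 2 n).+1) + J <= t)%N ->
    \sum_(xi : 'cV['Z_n]_d.+1 | xi != 0) normc (ft (walk_pmf A B t) xi) ^+ 2 <=
    (1 + Q%:R * th ^+ r) ^+ (c * (trunc_log 2 n).+1) - 1].
Proof.
have [J [th [th0 th1 hft]]] := ft_walk_le.
have [c hc] := code_separates hA hyp.
exists #|{: 'cV['Z_(mxsize A^T).+2]_d.+1}|, c, J, th; split=> //.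
move=> n r t n1 na r0 ht; set m := (c * _)%N in ht *.
pose w (s : nat) (xi : 'cV['Z_n]_d.+1) : R :=
  if code A a (orb A s xi) == 0 then 1 else th.
pose F xi : R := \prod_(s < m) w s xi.
have w0 s xi : 0 <= w s xi by rewrite /w; case: ifP => // _; exact: ltW.
have F0 xi : 0 <= F xi by apply: prodr_ge0.
apply: (@le_trans _ _ (\sum_(xi | xi != 0) F xi ^+ r)).
  apply: (@le_trans _ _ (\sum_(xi : 'cV['Z_n]_d.+1 | xi != 0)
      r%:R^-1 * \sum_(i < r) F (orb A (i * m) xi) ^+ r)).
    apply: ler_sum => xi _; apply: (le_trans (hft n xi (r * m)%N t n1 ht)).
    rewrite (prod_blocks (fun s => w s xi)).
    rewrite (eq_bigr (fun i : 'I_r => F (orb A (i * m) xi))).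
      by apply: prod_le_mean.
    by move=> i _; apply: eq_bigr => s _; rewrite /w orbD.
  rewrite -mulr_sumr exchange_big /=.
  rewrite (eq_bigr (fun=> \sum_(xi | xi != 0) F xi ^+ r)).
    rewrite sumr_const card_ord -[X in _ * X]mulr_natl.
    by rewrite mulKf ?pnatr_eq0 -?lt0n.
  move=> i _; rewrite [RHS](reindex_inj (@orb_inj _ A n (i * m) hA)) /=.
  apply: eq_bigl => xi; congr (~~ _).
  by rewrite -(inj_eq (@orb_inj _ A n (i * m) hA)) orb0.
rewrite (eq_bigr (fun xi => \prod_(s < m)
    (if code A a (orb A s xi) == 0 then 1 else th ^+ r))); last first.
  move=> xi _; rewrite /F -prodrXl; apply: eq_bigr => s _.
  by rewrite /w; case: ifP; rewrite ?expr1n.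
rewrite (eq_bigl (mem [set xi : 'cV['Z_n]_d.+1 | xi != 0]%SET)); last first.
  by move=> xi; rewrite !inE.
apply: (@sum_code_weight R _ _ 0 m (fun xi s => code A a (orb A s xi))).
- by rewrite exprn_ge0 // ltW.
- move=> xi xi' _ _ h; apply: (hc a n xi xi' n1 na) => s hs.
  exact: (h (Ordinal hs)).
- move=> xi; rewrite inE => xi0; apply: contrapT => /forallNP h.
  case/eqP: xi0; apply: (hc a n xi 0 n1 na) => s hs.
  rewrite orb0 code0 //; apply/eqP; rewrite -[_ == _]negbK; apply/negP.
  exact: (h (Ordinal hs)).
Qed.

End mixing_bound.

(** * Mixing time *)

Section tv.
Variables (R : realType) (d : nat) (mu : probability 'cV[int]_d R).
Variables (A : 'M[int]_d) (dT : measure_display) (T : measurableType dT).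
Variables (P : probability T R) (B : nat -> {RV P >-> 'cV[int]_d}).

Lemma tv_walk_le n t (e : R) : (1 < n)%N -> 0 <= e ->
  \sum_(xi : 'cV['Z_n]_d | xi != 0) normc (ft (walk_pmf A B t) xi) ^+ 2 <=
    e ^+ 2 ->
  tv_dist (finlaw P (fun w => walk A n (fun s => B s w) t))
          (@finuniform R 'cV['Z_n]_d) <= e.
Proof.
move=> n1 e0 he; apply: bigmax_le => // S _.
rewrite finlaw_walk -(@ler_pXn2r _ 2) ?nnegrE // real_normK ?num_real //.
apply: le_trans he; apply: sum_deviation_le => //.
exact: walk_pmf_sum.
Qed.

Lemma tv_dist_ge0 (X : finType) (p q : {set X} -> R) : 0 <= tv_dist p q.
Proof. exact: bigmax_ge_id. Qed.

End tv.

Lemma trunc_log2_le (R : realType) (n : nat) : (0 < n)%N ->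
  (trunc_log 2 n)%:R <= 2 * ln n%:R :> R.
Proof.
move=> n0.
have ln2 : 2^-1 <= ln 2 :> R.
  have : ln (1 + - 2^-1) <= - 2^-1 :> R by apply: le_ln1Dx; lra.
  have -> : 1 + - 2^-1 = 2^-1 :> R by lra.
  by rewrite lnV ?posrE // => h; lra.
have : ln ((2 ^ trunc_log 2 n)%N%:R) <= ln n%:R :> R.
  by rewrite ler_ln ?posrE ?ltr0n ?expn_gt0 // ler_nat trunc_logP.
rewrite natrX lnXn // -[_ *+ trunc_log 2 n]mulr_natr => h.
have : 2^-1 * (trunc_log 2 n)%:R <= ln 2 * (trunc_log 2 n)%:R :> R.
  by rewrite ler_wpM2r.
by move=> h'; lra.
Qed.

(** The lower bound on n ensures that ln (ln n) >= 1, which absorbs the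
    additive constants; the factors of 21 = 3 * 7 come from ln 2 >= 1/2 and
    ln 3 <= 2. *)
Lemma log_loglog_le (R : realType) (n : nat) : expR (expR 1) <= n%:R :> R ->
  (((trunc_log 2 n).+1 * (trunc_log 2 (trunc_log 2 n).+1).+1)%N%:R : R)
    <= 21 * ln n%:R * ln (ln n%:R).
Proof.
move=> hn; set l := (trunc_log 2 n).+1; set L := ln (n%:R : R).
have n0 : (0 < n%:R :> R) by apply: lt_le_trans hn; apply: expR_gt0.
have L1 : expR 1 <= L by rewrite -(expRK (expR 1)) ler_ln ?posrE ?expR_gt0.
have L0 : 0 < L by apply: lt_le_trans L1; apply: expR_gt0.
have LL1 : 1 <= ln L by rewrite -[leLHS](@expRK R) ler_ln ?posrE ?expR_gt0.
have L2 : 2 <= L by apply: le_trans L1; have := expR_ge1Dx (1 : R); lra.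
have hl : l%:R <= 3 * L.
  have := trunc_log2_le R (n := n); rewrite -(ltr0n R) => /(_ n0).
  by rewrite /l -natr1 -/L => h; lra.
have hll : (trunc_log 2 l).+1%:R <= 7 * ln L.
  have := trunc_log2_le R (n := l) isT; rewrite -natr1.
  have : ln (l%:R : R) <= ln (3 * L) by rewrite ler_ln ?posrE ?ltr0n ?mulr_gt0.
  rewrite lnM ?posrE //.
  have : ln (1 + 2) <= 2 :> R by apply: le_ln1Dx; lra.
  have -> : 1 + 2 = 3 :> R by lra.
  by move=> h1 h2 h3; lra.
rewrite natrM; have -> : 21 * L * ln L = (3 * L) * (7 * ln L) by ring.
by apply: ler_pM.
Qed.

(** Let q = c Q + 1. If th^k <= 1 / (4 q), then the power of th below is at
    most 1 / (l^2 q), because 2 ^ (trunc_log 2 l + 1) > l. Hence the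
    left-hand side is at most exp (1 / l) - 1 <= 1 / (1 - 1 / l) - 1 = 1 /
    (l - 1). *)
Lemma code_mass_small (R : realType) (Q c : nat) (th : R) : 0 < th -> th < 1 ->
  exists k : nat, forall l : nat, (1 < l)%N ->
    (1 + Q%:R * th ^+ (k.+1 * (trunc_log 2 l).+1)) ^+ (c * l) - 1 <=
    (l.-1)%:R^-1.
Proof.
move=> th0 th1; set q : R := c%:R * Q%:R + 1.
have q0 : 0 <= c%:R * Q%:R :> R by rewrite mulr_ge0.
have q1 : 1 <= q by rewrite /q; lra.
have q4 : 0 < (4 * q)^-1 by rewrite invr_gt0; lra.
have [k hk] := expr_small (ltW th0) th1 q4.
exists k => l l1; set la := (trunc_log 2 l).+1.
have l0 : 1 < l%:R :> R by rewrite ltr1n.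
have hla : l%:R < 2 ^+ la :> R by rewrite -natrX ltr_nat trunc_log_ltn.
have hth : th ^+ (k.+1 * la) <= (l%:R ^+ 2 * q)^-1.
  rewrite exprM; apply: (@le_trans _ _ ((4 * q)^-1 ^+ la)).
    apply: lerXn2r; rewrite ?nnegrE; first exact/exprn_ge0/ltW.
      exact: ltW.
    apply: le_trans hk; rewrite exprS ler_piMl //; last exact: ltW.
    exact/exprn_ge0/ltW.
  have p1 : 0 < (4 * q) ^+ la by rewrite exprn_gt0 //; lra.
  have p2 : 0 < l%:R ^+ 2 * q by rewrite mulr_gt0 ?exprn_gt0 //; lra.
  rewrite exprVn lef_pV2 ?posrE //.
  rewrite exprMn; apply: ler_pM; rewrite ?exprn_ge0 //; try lra.
    have -> : 4 = 2 ^+ 2 :> R by lra.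
    by rewrite -exprM mulnC exprM lerXn2r ?nnegrE ?exprn_ge0 // ltW.
  by rewrite /la exprS ler_peMr ?exprn_ege1 //; lra.
set x := Q%:R * _.
have x0 : 0 <= x by rewrite mulr_ge0 // exprn_ge0 // ltW.
have hx : (c * l)%:R * x <= l%:R^-1.
  rewrite natrM /x.
  apply: (@le_trans _ _ (c%:R * l%:R * (Q%:R * (l%:R ^+ 2 * q)^-1))).
    by rewrite !ler_wpM2l ?mulr_ge0.
  have -> : c%:R * l%:R * (Q%:R * (l%:R ^+ 2 * q)^-1) =
      (c%:R * Q%:R / q) * l%:R^-1.
    by field; apply/andP; split; apply: lt0r_neq0; lra.
  rewrite ler_piMl ?invr_ge0 ?ler0n // ler_pdivrMr ?mul1r /q; lra.
have y0 : 0 < 1 - l%:R^-1 :> R by rewrite subr_gt0 invf_lt1 //; lra.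
have : (1 + x) ^+ (c * l) <= (1 - l%:R^-1)^-1.
  apply: (@le_trans _ _ (expR ((c * l)%:R * x))).
    by rewrite expRM_natl lerXn2r ?nnegrE ?expR_ge0 ?expR_ge1Dx ?addr_ge0.
  apply: (@le_trans _ _ (expR l%:R^-1)); first by rewrite ler_expR.
  rewrite -[leLHS]invrK -expRN lef_pV2 ?posrE ?expR_gt0 //.
  exact: expR_ge1Dx.
have -> : l.-1%:R = l%:R - 1 :> R.
  by rewrite -[in RHS](prednK (ltnW l1)) -natr1 addrK.
have -> : (l%:R - 1)^-1 = (1 - l%:R^-1)^-1 - 1 :> R.
  by field; apply/andP; split; apply: lt0r_neq0; lra.
by move=> h; lra.
Qed.

Lemma coprime_prodn (I : finType) (a : I -> nat) n :
  (forall i, coprime n (a i)) -> coprime n (\prod_i a i).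
Proof.
move=> h; apply: (big_ind (fun m => coprime n m)) => // [|x y].
  exact: coprimen1.
by rewrite coprimeMr => -> ->.
Qed.

Unset Implicit Arguments.

Theorem theorem1 (R : realType) (d : nat) (hd : (2 <= d)%N)
  (mu : probability 'cV[int]_d R)
  (A : 'M[int]_d) (hA : A \in unitmx)
  (dT : measure_display) (T : measurableType dT) (P : probability T R)
  (B : nat -> {RV P >-> 'cV[int]_d})
  (hB : iid [set t : nat | (1 <= t)%N] B mu)
  (H : set 'cV[int]_d)
  (hH : H = invariant_hull A [set x - y | x in supp mu & y in supp mu])
  (hrank : has_rank H d)
  (u : 'I_d -> 'cV[int]_d) (hu : Zbasis u)
  (a : 'I_d -> nat) (ha : forall i, (0 < a i)%N)
  (hgen : H = generated (range (fun i => u i *+ a i)))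
  (hhyp : hyperbolic R A) :
  exists2 C : R, 0 < C &
    sup [set tv_dist (finlaw P (fun w => walk A n (fun s => B s w) t))
                     (@finuniform R 'cV['Z_n]_d)
        | t in [set t : nat | C * ln n%:R * ln (ln n%:R) < t%:R]]
      @[n --> within [set n : nat | forall i, coprime n (a i)] \oo]
      --> (0 : R).
Proof.
case: d hd mu A hA B hB H hH hrank u hu a ha hgen hhyp => // d _ mu A hA B hB
  H hH _ u hu a _ hgen hyp.
have hctrl h : controlled mu A (h *+ \prod_i a i).
  by apply: hull_controlled; rewrite -hH hgen; apply: generated_smul.
have [Q [c [J [th [th0 th1 hft]]]]] := fourier_bound hB hctrl hA hyp.
have [k hk] := code_mass_small Q c th0 th1.
(* The k.+1 * (log log n) blocks of length c * log n, and the J extra steps. *)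
pose D := (k.+1 * c + J).+1.
exists (21 * D%:R); first by rewrite mulr_gt0 // ltr0n.
apply/cvgrPdist_le => e e0.
pose N := (Num.bound (expR (expR (1 : R))) + 2 ^ (Num.bound (e ^- 2)).+1)%N.
exists N => // n /= hn hcop.
have hn1 : expR (expR 1) <= n%:R :> R.
  apply: (le_trans (ltW (archi_boundP (expR_ge0 _)))); rewrite ler_nat.
  by apply: leq_trans hn; rewrite leq_addr.
have hn2 : (Num.bound (e ^- 2) < trunc_log 2 n)%N.
  rewrite -(@trunc_expnK 2 _.+1) // leq_trunc_log //.
  by apply: leq_trans hn; rewrite leq_addl.
have n1 : (1 < n)%N.
  rewrite ltnNge; apply/negP => n_le.
  by case: n n_le hn2 {hn hcop hn1} => [|[|]].
set l := (trunc_log 2 n).+1 in hn2.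
set S := (X in sup X).
have SP x : S x -> 0 <= x <= e.
  case=> t /= ht <-; rewrite tv_dist_ge0 /=.
  apply: tv_walk_le => //; first exact: ltW.
  have := hft n (k.+1 * (trunc_log 2 l).+1)%N t n1 (coprime_prodn hcop) isT.
  rewrite -/l => /(_ _)/le_trans; apply.
    rewrite -(ler_nat R); apply: le_trans (ltW ht).
    have := log_loglog_le hn1; rewrite -/l => hlog.
    have DR : 0 <= D%:R :> R by [].
    apply: (@le_trans _ _ (D%:R * (l * (trunc_log 2 l).+1)%N%:R)).
      rewrite -natrM ler_nat /D.
      have : (0 < l * (trunc_log 2 l).+1)%N by [].
      move: (trunc_log 2 l).+1 => la; nia.
    apply: (le_trans (ler_wpM2l DR hlog)).
    by rewrite le_eqVlt; apply/orP; left; apply/eqP; ring.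
  have tl0 : (0 < trunc_log 2 n)%N by apply: leq_ltn_trans hn2.
  apply: (le_trans (hk l _)); first by rewrite /l ltnS.
  rewrite /l /= -[leRHS]invrK lef_pV2 ?posrE ?invr_gt0 ?exprn_gt0 ?ltr0n //.
  apply: (le_trans (ltW (archi_boundP _))).
    by rewrite invr_ge0 exprn_ge0 // ltW.
  by rewrite ler_nat ltnW.
have [t0 St0] : S !=set0.
  eexists; exists (Num.bound `|21 * D%:R * ln (n%:R : R) * ln (ln (n%:R : R))|);
    last reflexivity.
  rewrite /=; apply: le_lt_trans (archi_boundP (normr_ge0 _)).
  exact: ler_norm.
have [t00 _] := andP (SP _ St0).
rewrite sub0r normrN ger0_norm.
  by apply: ge_sup; [exists t0|move=> x /SP/andP[]].
apply: (le_trans t00); apply: ub_le_sup => //.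
by exists e => x /SP/andP[].
Qed.
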